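(* Let $q$ be a prime power, let $s\ge 1$ be an integer, let $F$ be a global function field with full constant field $\mathbb{F}_q$ and genus $g$, and let $P_\infty,P_1,\ldots,P_s$ be $s+1$ distinct places of $F$ with $\deg(P_\infty)=1$. Put $e_i=\deg(P_i)$ for $1\le i\le s$ and $\boldsymbol{e}=(e_1,\ldots,e_s)$. Then the matrices $C^{(1)},\ldots,C^{(s)}\in\mathbb{F}_q^{\mathbb{N}\times\mathbb{N}_0}$ given by the columnwise construction (described in the context) from $F,P_\infty,P_1,\ldots,P_s$ generate, by the digital method, a $(u,\boldsymbol{e},s)$-sequence in base $q$ with $u=g$.
   Context: **Columnwise construction.** For a divisor $D$ of $F$ let $\mathcal{L}(D)=\{f\in F^*:\mathrm{div}(f)+D\ge 0\}\cup\{0\}$ be the Riemann-Roch space and $\ell(D)$ its dimension over $\mathbb{F}_q$. The gap numbers of $P_\infty$ are the $g$ positive integers $n$ with $\ell(nP_\infty)=\ell((n-1)P_\infty)$. Let $n_0<n_1<n_2<\cdots$ be the elements of $\mathbb{N}_0$ that are not gap numbers of $P_\infty$, in increasing order. For each $r\ge 0$ choose any $y_r\in\mathcal{L}(n_rP_\infty)\setminus\mathcal{L}((n_r-1)P_\infty)$. For $1\le i\le s$ choose a local parameter $z_i$ at $P_i$ (i.e. $\nu_{P_i}(z_i)=1$); since $\nu_{P_i}(y_r)\ge 0$, the local expansion of $y_r$ at $P_i$ is $y_r=\sum_{k=0}^\infty\beta^{(i)}_{k,r}z_i^k$ with $\beta^{(i)}_{k,r}\in\mathbb{F}_{q^{e_i}}$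 (the residue class field of $P_i$; the expansion takes place in the completion of $F$ at $P_i$, identified with $\mathbb{F}_{q^{e_i}}((z_i))$). Using a fixed ordered basis of $\mathbb{F}_{q^{e_i}}/\mathbb{F}_q$, identify $\beta^{(i)}_{k,r}$ with a column vector $\boldsymbol{b}^{(i)}_{k,r}\in\mathbb{F}_q^{e_i}$. Column $r$ ($r\ge 0$) of $C^{(i)}=(c^{(i)}_{j,r})_{j\ge1,r\ge0}$ is the concatenation of $\boldsymbol{b}^{(i)}_{0,r},\boldsymbol{b}^{(i)}_{1,r},\boldsymbol{b}^{(i)}_{2,r},\ldots$; i.e. $c^{(i)}_{ke_i+h,r}$ is the $h$th coordinate of $\boldsymbol{b}^{(i)}_{k,r}$ for $k\ge0$, $1\le h\le e_i$. **Digital method.** Let $Z_q=\{0,1,\ldots,q-1\}\subset\mathbb{Z}$. Choose bijections $\psi_r:Z_q\to\mathbb{F}_q$ ($r\ge0$) with $\psi_r(0)=0$ for all sufficiently large $r$, and bijections $\lambda_{i,j}:\mathbb{F}_q\to Z_q$ ($1\le i\le s$, $j\ge1$); these choices are arbitrary. For $n\ge0$ with base-$q$ expansion $n=\sum_{r\ge0}z_r(n)q^r$, put $y^{(i)}_{n,j}=\sum_{r\ge0}c^{(i)}_{j,r}\psi_r(z_r(n))\in\mathbb{F}_q$ and $x^{(i)}_n=\sum_{j\ge1}\lambda_{i,j}(y^{(i)}_{n,j})q^{-j}$. The sequence generated by $C^{(1)},\ldots,C^{(s)}$ is $\boldsymbol{x}_n=(x_n^{(1)},\ldots,x_n^{(s)})$,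 $n\ge0$. **Nets and sequences.** Point sets are counted with multiplicity: for a point set $\mathcal{P}$ (finite indexed family), $A(J;\mathcal{P})$ is the number of indices $n$ with $\boldsymbol{x}_n\in J$. Let $b\ge2$, $s\ge1$, $0\le u\le m$ be integers, $\boldsymbol{e}=(e_1,\ldots,e_s)\in\mathbb{N}^s$. A *$(u,m,\boldsymbol{e},s)$-net in base $b$* is a point set $\mathcal{P}$ of $b^m$ points in $[0,1)^s$ such that $A(J;\mathcal{P})=b^m\,\mathrm{Vol}(J)$ for every interval $J=\prod_{i=1}^s[a_ib^{-d_i},(a_i+1)b^{-d_i})$ with integers $d_i\ge0$, $0\le a_i<b^{d_i}$, $e_i\mid d_i$ for $1\le i\le s$, and $\mathrm{Vol}(J)\ge b^{u-m}$. For an integer $u\ge0$, a sequence $\boldsymbol{x}_0,\boldsymbol{x}_1,\ldots$ in $[0,1]^s$ is a *$(u,\boldsymbol{e},s)$-sequence in base $b$* if for all integers $k\ge0$ and $m>u$ the points $[\boldsymbol{x}_n]_{b,m}$, $kb^m\le n<(k+1)b^m$, form a $(u,m,\boldsymbol{e},s)$-net in base $b$. Here $[\boldsymbol{x}_n]_{b,m}$ is the coordinatewise $m$-digit truncation in base $b$, taken with respect to the given digit expansion of each coordinate (for the digital method: $\sum_{j\ge1}\lambda_{i,j}(y^{(i)}_{n,j})q^{-j}$ is truncated to $\sum_{j=1}^m$). *)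

(* Defs.v *)
From HB Require Import structures.
From mathcomp Require Import all_boot all_order all_algebra all_field.
From mathcomp Require Import all_classical reals topology normedtype sequences.

Set Implicit Arguments.
Unset Strict Implicit.
Unset Printing Implicit Defensive.

Import Order.TTheory GRing.Theory Num.Theory.
Import numFieldNormedType.Exports.

Local Open Scope classical_set_scope.
Local Open Scope ring_scope.

(* The K-algebra structure of a field F is given by an embedding iota : K -> F;
   MathComp's [fieldExtType] only covers finite extensions. *)

Definition algebraic_elt (K F : fieldType) (iota : {rmorphism K -> F}) (x : F)
    : Prop :=
  exists2 p : {poly K}, p != 0 & root (map_poly iota p) x.

Definition in_simple_ext (K F : fieldType) (iota : {rmorphism K -> F})
    (x f : F) : Prop :=
  exists p r : {poly K},
    (map_poly iota r).[x] != 0 /\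
    f = (map_poly iota p).[x] / (map_poly iota r).[x].

Definition function_field (K F : fieldType) (iota : {rmorphism K -> F})
    : Prop :=
  exists x : F, ~ algebraic_elt iota x /\
    exists (n : nat) (b : 'I_n -> F), forall f : F,
      exists c : 'I_n -> F,
        (forall i, in_simple_ext iota x (c i)) /\ f = \sum_(i < n) c i * b i.

Definition full_constant_field (K F : fieldType) (iota : {rmorphism K -> F})
    : Prop :=
  forall x : F, algebraic_elt iota x -> exists a : K, x = iota a.

(* [quot_dim_is iota V W n]: the K-space V / W has a basis of n elements
   (W being a subspace of V). *)
Definition quot_dim_is (K F : fieldType) (iota : {rmorphism K -> F})
    (V W : set F) (n : nat) : Prop :=
  exists b : 'I_n -> F, (forall i, V (b i)) /\
    forall f : F, V f ->
      exists! c : {ffun 'I_n -> K}, W (f - \sum_(i < n) iota (c i) * b i).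

Definition quot_dim (K F : fieldType) (iota : {rmorphism K -> F})
    (V W : set F) : nat :=
  xget 0%N [set n | quot_dim_is iota V W n].

(* A normalized discrete valuation.  The value at 0, which should be +oo, is
   set to 0 so that a valuation is determined by its values on F^*; use
   [val_ge], which follows the convention v(0) = +oo, to compare. *)
Definition discrete_valuation (F : fieldType) (v : F -> int) : Prop :=
  [/\ v 0 = 0,
      forall x y, x != 0 -> y != 0 -> v (x * y) = v x + v y,
      forall x y, x != 0 -> y != 0 -> x + y != 0 ->
        Num.min (v x) (v y) <= v (x + y)
    & exists2 x, x != 0 & v x = 1].

Definition val_ge (F : fieldType) (v : F -> int) (n : int) (x : F) : Prop :=
  x = 0 \/ n <= v x.

(* A place is identified with its normalized discrete valuation. *)
Record place (K F : fieldType) (iota : {rmorphism K -> F}) := Place {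
  place_val :> F -> int;
  place_valP : discrete_valuation place_val;
  place_const : forall a : K, a != 0 -> place_val (iota a) = 0 }.

HB.instance Definition _ (K F : fieldType) (iota : {rmorphism K -> F}) :=
  gen_eqMixin (place iota).
HB.instance Definition _ (K F : fieldType) (iota : {rmorphism K -> F}) :=
  gen_choiceMixin (place iota).

(* The dimension over K of the residue class field O_P / m_P. *)
Definition deg_place (K F : fieldType) (iota : {rmorphism K -> F})
    (P : place iota) : nat :=
  quot_dim iota [set f | val_ge P 0 f] [set f | val_ge P 1 f].

Definition is_divisor (K F : fieldType) (iota : {rmorphism K -> F})
    (D : place iota -> int) : Prop :=
  finite_set [set P | D P != 0].

Definition deg_divisor (K F : fieldType) (iota : {rmorphism K -> F})
    (D : place iota -> int) : int :=
  \sum_(P \in [set: place iota]) D P * (deg_place P)%:Z.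

Definition place_mul (K F : fieldType) (iota : {rmorphism K -> F})
    (P : place iota) (n : int) : place iota -> int :=
  fun Q => if Q == P then n else 0.

Definition RR_space (K F : fieldType) (iota : {rmorphism K -> F})
    (D : place iota -> int) : set F :=
  [set f | f = 0 \/ forall P : place iota, 0 <= P f + D P].

Definition ell (K F : fieldType) (iota : {rmorphism K -> F})
    (D : place iota -> int) : nat :=
  quot_dim iota (RR_space D) [set 0].

Definition genus_is (K F : fieldType) (iota : {rmorphism K -> F}) (g : nat)
    : Prop :=
  (forall D : place iota -> int, is_divisor D ->
     deg_divisor D - (ell D)%:Z + 1 <= g%:Z) /\
  (exists D : place iota -> int,
     is_divisor D /\ deg_divisor D - (ell D)%:Z + 1 = g%:Z).

Definition gap_number (K F : fieldType) (iota : {rmorphism K -> F})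
    (P : place iota) (n : nat) : Prop :=
  (0 < n)%N /\ ell (place_mul P n%:Z) = ell (place_mul P (n%:Z - 1)).

Definition increasing_enumeration (A : set nat) (u : nat -> nat) : Prop :=
  (forall r, (u r < u r.+1)%N) /\ range u = A.

Record completion (F : fieldType) (v : F -> int) := Completion {
  compl_field : fieldType;
  compl_emb : {rmorphism F -> compl_field};
  compl_val : compl_field -> int;
  compl_valP : discrete_valuation compl_val;
  compl_val_emb : forall f, compl_val (compl_emb f) = v f;
  compl_dense : forall (x : compl_field) (n : int),
    exists f, val_ge compl_val n (x - compl_emb f);
  compl_complete : forall u : nat -> compl_field,
    (forall n : int, exists N : nat, forall i j,
       (N <= i)%N -> (N <= j)%N -> val_ge compl_val n (u i - u j)) ->
    exists l, forall n : int, exists N : nat, forall i,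
      (N <= i)%N -> val_ge compl_val n (u i - l) }.

(* The completion at P, together with the residue class field of P realized as
   a subfield of it: [residue_rep] maps the field onto a system of
   representatives of O_P / m_P, so that every choice of a local parameter z
   identifies the completion with [residue_field]((z)). *)
Record local_field (K F : fieldType) (iota : {rmorphism K -> F})
    (P : place iota) := LocalField {
  local_compl :> completion P;
  residue_field : fieldExtType K;
  residue_rep : {rmorphism residue_field -> compl_field local_compl};
  residue_rep_const : forall a : K,
    residue_rep a%:A = compl_emb local_compl (iota a);
  residue_rep_onto : forall f : F, val_ge P 0 f ->
    exists beta, val_ge (compl_val (c := local_compl)) 1
                   (compl_emb local_compl f - residue_rep beta) }.

Definition local_expansion (K F : fieldType) (iota : {rmorphism K -> F})
    (P : place iota) (L : local_field P) (z y : F)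
    (beta : nat -> residue_field L) : Prop :=
  forall N : nat,
    val_ge (compl_val (c := local_compl L)) N%:Z
      (compl_emb L y
       - \sum_(k < N) residue_rep L (beta k) * compl_emb L z ^+ k).

(* Rows j >= 1 are numbered from 0: [C i j r] is the entry in row j + 1 and
   column r of the i-th matrix. *)
Definition columnwise_matrices (K F : fieldType) (iota : {rmorphism K -> F})
    (s : nat) (P : 'I_s -> place iota) (L : forall i, local_field (P i))
    (bas : forall i, (deg_place (P i)).-tuple (residue_field (L i)))
    (beta : forall i, nat -> nat -> residue_field (L i))
    (C : 'I_s -> nat -> nat -> K) : Prop :=
  forall (i : 'I_s) (k r : nat) (h : 'I_(deg_place (P i))),
    C i (k * deg_place (P i) + h)%N r = coord (bas i) h (beta i k r).

Definition base_digit (q n r : nat) : nat := ((n %/ q ^ r) %% q)%N.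

(* Row j stands for row j + 1, as above; the sum over r has finite support when
   psi r 0 = 0 for all large r. *)
Definition digital_y (K : fieldType) (s q : nat) (C : 'I_s -> nat -> nat -> K)
    (psi : nat -> nat -> K) (n : nat) (i : 'I_s) (j : nat) : K :=
  \sum_(r \in [set: nat]) C i j r * psi r (base_digit q n r).

Definition digital_digit (K : fieldType) (s q : nat)
    (C : 'I_s -> nat -> nat -> K) (psi : nat -> nat -> K)
    (lambda : 'I_s -> nat -> K -> nat) (n : nat) (i : 'I_s) (j : nat) : nat :=
  lambda i j (digital_y q C psi n i j).

Definition expansion_series (R : realType) (b : nat) (dig : nat -> nat)
    : nat -> R :=
  series (fun j => (dig j)%:R / b%:R ^+ j.+1).

Definition digital_sequence (R : realType) (K : fieldType) (s q : nat)
    (C : 'I_s -> nat -> nat -> K) (psi : nat -> nat -> K)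
    (lambda : 'I_s -> nat -> K -> nat) (n : nat) (i : 'I_s) : R :=
  limn (expansion_series R q (digital_digit q C psi lambda n i)).

Definition box_count (R : realType) (s N : nat) (X : 'I_N -> 'I_s -> R)
    (lo hi : 'I_s -> R) : nat :=
  #|[set n : 'I_N | [forall i, (lo i <= X n i) && (X n i < hi i)]]%SET|.

Definition box_volume (R : realType) (s : nat) (lo hi : 'I_s -> R) : R :=
  \prod_(i < s) (hi i - lo i).

Definition is_net (R : realType) (b u m s : nat) (e : 'I_s -> nat)
    (X : 'I_(b ^ m) -> 'I_s -> R) : Prop :=
  (forall n i, 0 <= X n i < 1) /\
  forall (d a : 'I_s -> nat),
    (forall i, (a i < b ^ d i)%N) ->
    (forall i, (e i %| d i)%N) ->
    let lo i := (a i)%:R / b%:R ^+ d i in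
    let hi i := (a i).+1%:R / b%:R ^+ d i in
    b%:R ^ (u%:Z - m%:Z) <= box_volume lo hi ->
    (box_count X lo hi)%:R = b%:R ^+ m * box_volume lo hi.

(* [dig n i] is the given base-b digit expansion of the coordinate [x n i]
   ([dig n i j] being the digit of b^-(j+1)), with respect to which truncation
   is taken. *)
Definition is_sequence (R : realType) (b u s : nat) (e : 'I_s -> nat)
    (x : nat -> 'I_s -> R) (dig : nat -> 'I_s -> nat -> nat) : Prop :=
  [/\ forall n i, 0 <= x n i <= 1,
      forall n i, (forall j, (dig n i j < b)%N) /\
        (expansion_series R b (dig n i) @ \oo --> x n i)
    & forall k m : nat, (u < m)%N ->
        is_net u e (fun (n : 'I_(b ^ m)) (i : 'I_s) =>
          expansion_series R b (dig (k * b ^ m + n)%N i) m)].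

(* Main.v *)
Require Import Defs.
From HB Require Import structures.
From mathcomp Require Import all_boot all_order all_algebra all_field.
From mathcomp Require Import all_classical reals topology normedtype sequences.
From mathcomp Require Import zify.

Set Implicit Arguments.
Unset Strict Implicit.
Unset Printing Implicit Defensive.

Import Order.TTheory GRing.Theory Num.Theory.
Import numFieldNormedType.Exports.

Local Open Scope classical_set_scope.
Local Open Scope ring_scope.

(* Every place has finite degree, by counting dimensions over K.  If L(0) had
   infinite dimension, the Riemann bound ell D >= deg D + 1 - g would fail for
   multiples of Pinf; hence L(0) = K, and powers of functions show that L(D) = 0
   when deg D < 0.  Equality in the Riemann bound holds for D + n Pinf, n large,
   and, by pairing pole numbers of Pinf with jumps of ell along D + Z Pinf, as
   soon as deg D >= 2 g - 1; no duality is needed.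
   The first m columns come from linearly independent functions
   y_0, ..., y_(m-1) of L((g + m - 1) Pinf).  When sum_i l_i e_i <= m - g, their
   combinations with vanishing first l_i e_i coordinates at every P_i lie in
   L((g + m - 1) Pinf - sum_i l_i P_i), which has dimension m - sum_i l_i e_i.
   So the rows involved are linearly independent, and every elementary interval
   pulls back to a fibre of a surjective affine map on K^m. *)

(** Both [ell] and [deg_place] are values of [quot_dim], which is 0 when no finite basis exists.
    Finite dimension ([fin_RR]) must therefore be proved before any two dimensions are compared, and
    every embedding or inclusion lemma transports it along with the inequality. For principal
    divisors the inequality deg (div f) <= 0 is derived; it enters an upper bound for [ell], where
    this is the right direction. The constant 2 g comes from counting in steps of Pinf from degree
    -1, where [ell] is 0: by the Riemann bound at most g positions fail to be jumps, for D + Z Pinf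
    and for Z Pinf alike. A failure at M would pair at least M + 1 - g jumps of the second sequence
    with at most g failures of the first, so M + 1 <= 2 g. *)

(** * Linear algebra over K in quotients of subspaces of F *)

Section LinearAlgebraModSubspace.
Variables (K F : fieldType) (iota : {rmorphism K -> F}).
Implicit Types (U V W : set F).

Definition lincomb (I : finType) (b : I -> F) (c : I -> K) : F :=
  \sum_i iota (c i) * b i.

Definition subspace W := W 0 /\ forall a x y, W x -> W y -> W (iota a * x + y).

(** Independence of the classes in F / W: W = 0 serves the spaces L(D), W = m_P the residue fields,
    and W = L(D) the quotients L(D + P) / L(D). *)
Definition indep_mod W (I : finType) (b : I -> F) :=
  forall c : I -> K, W (lincomb b c) -> forall i, c i = 0.

Definition in_span_mod W (I : finType) (b : I -> F) (f : F) :=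
  exists c : I -> K, W (f - lincomb b c).

Lemma subspaceD W x y : subspace W -> W x -> W y -> W (x + y).
Proof. by case=> _ h wx wy; move: (h 1 x y wx wy); rewrite rmorph1 mul1r. Qed.

Lemma subspaceZ W a x : subspace W -> W x -> W (iota a * x).
Proof. by case=> w0 h wx; move: (h a x 0 wx w0); rewrite addr0. Qed.

Lemma subspaceN W x : subspace W -> W x -> W (- x).
Proof.
by move=> sW wx; rewrite -mulN1r -(rmorph1 iota) -rmorphN; apply: subspaceZ.
Qed.

Lemma subspaceB W x y : subspace W -> W x -> W y -> W (x - y).
Proof. by move=> sW wx wy; apply: subspaceD => //; apply: subspaceN. Qed.

Lemma subspace_sum W (I : Type) (r : seq I) (Q : pred I) (f : I -> F) :
  subspace W -> (forall i, Q i -> W (f i)) -> W (\sum_(i <- r | Q i) f i).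
Proof.
move=> sW h; apply: (big_ind W) => //; first by case: sW.
by move=> x y; apply: subspaceD.
Qed.

Lemma subspace_lincomb W (I : finType) (b : I -> F) c :
  subspace W -> (forall i, W (b i)) -> W (lincomb b c).
Proof. by move=> sW h; apply: subspace_sum => // i _; apply: subspaceZ. Qed.

Lemma subspace_zero : subspace [set 0].
Proof. by split=> //= a x y -> ->; rewrite mulr0 addr0. Qed.

Lemma lincombB (I : finType) (b : I -> F) c c' :
  lincomb b c - lincomb b c' = lincomb b (fun i => c i - c' i).
Proof.
by rewrite /lincomb -sumrB; apply: eq_bigr => i _; rewrite rmorphB mulrBl.
Qed.

(** A coefficient matrix with more rows than columns has a nonzero left kernel vector, which is a
    relation modulo W among the [a i]. *)
Lemma card_indep_le W (I J : finType) (a : I -> F) (b : J -> F) :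
  subspace W -> indep_mod W a -> (forall i, in_span_mod W b (a i)) ->
  (#|I| <= #|J|)%N.
Proof.
move=> sW ia /choice[c hc]; rewrite leqNgt; apply/negP => ltJI.
pose M : 'M[K]_(#|I|, #|J|) := \matrix_(i, j) c (enum_val i) (enum_val j).
have : kermx M != 0.
  rewrite -mxrank_eq0 mxrank_ker -lt0n subn_gt0.
  exact: leq_ltn_trans (rank_leq_col M) ltJI.
case/rowV0Pn => u /sub_kermxP uM u0.
have uc j : \sum_i u 0 (enum_rank i) * c i j = 0.
  move/matrixP/(_ 0 (enum_rank j)): uM; rewrite !mxE; apply: etrans.
  rewrite [LHS](reindex (@enum_val I I)) /=; last first.
    by exists enum_rank => i _; [apply: enum_valK | apply: enum_rankK].
  by apply: eq_bigr => i _; rewrite enum_valK !mxE enum_rankK.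
have /ia h : W (lincomb a (fun i => u 0 (enum_rank i))).
  rewrite (_ : lincomb a _ =
    \sum_i iota (u 0 (enum_rank i)) * (a i - lincomb b (c i))).
    by apply: subspace_sum => // i _; apply: subspaceZ.
  under eq_bigr => i _ do rewrite mulrBr.
  rewrite sumrB -[LHS]subr0; congr (_ - _); apply/esym.
  under eq_bigr => i _ do rewrite /lincomb mulr_sumr.
  rewrite exchange_big big1 // => j _.
  under eq_bigr => i _ do rewrite mulrA -rmorphM.
  by rewrite -mulr_suml -rmorph_sum uc rmorph0 mul0r.
case/eqP: u0; apply/rowP => i; rewrite mxE -[i]enum_valK; exact: h.
Qed.

Lemma quot_dimP V W n : subspace V -> subspace W ->
  quot_dim_is iota V W n <->
  exists b : 'I_n -> F, [/\ forall i, V (b i), indep_mod W b &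
    forall f, V f -> in_span_mod W b f].
Proof.
move=> sV sW; split=> -[b].
- case=> Vb h; exists b; split=> //; last by move=> f /h[c [hc _]]; exists c.
  move=> c Wc i.
  have [c1 [_ uc]] := h _ (subspace_lincomb c sV Vb).
  (* The combination lies in W, so both c and 0 are coordinate vectors for it; uniqueness identifies
     them. *)
  have /uc e1 : W (lincomb b c - \sum_(i < n) iota (finfun c i) * b i).
    under eq_bigr => j _ do rewrite ffunE.
    by rewrite subrr; case: sW.
  have /uc e2 : W (lincomb b c - \sum_(i < n) iota ([ffun=> 0] i) * b i).
    rewrite [X in _ - X]big1 ?subr0 // => j _.
    by rewrite ffunE rmorph0 mul0r.
  by move/ffunP: (esym e1) => /(_ i); rewrite ffunE => ->; rewrite e2 ffunE.
- case=> Vb ib sb; exists b; split=> // f /sb[c hc]; exists (finfun c); split.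
    by under eq_bigr => j _ do rewrite ffunE.
  move=> c' hc'; apply/ffunP => i; rewrite ffunE; apply/eqP.
  rewrite -subr_eq0; apply/eqP; apply: (ib (fun j => c j - c' j)).
  rewrite -lincombB.
  rewrite (_ : _ - _ = (f - lincomb b c') - (f - lincomb b c)).
    exact: subspaceB.
  by rewrite opprB [RHS]addrC addrA subrK.
Qed.

Lemma quot_dim_card_le V W n (I : finType) (a : I -> F) :
  subspace V -> subspace W -> quot_dim_is iota V W n ->
  (forall i, V (a i)) -> indep_mod W a -> (#|I| <= n)%N.
Proof.
move=> sV sW /(quot_dimP _ sV sW)[b [_ _ sb]] Va ia.
by rewrite -[n]card_ord; apply: (card_indep_le sW ia) => i; apply: sb.
Qed.

Lemma quot_dimE V W n : subspace V -> subspace W ->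
  quot_dim_is iota V W n -> quot_dim iota V W = n.
Proof.
move=> sV sW h; apply: xget_unique => // k hk.
have [b [Vb ib _]] := (quot_dimP _ sV sW).1 h.
have [c [Vc ic _]] := (quot_dimP _ sV sW).1 hk.
apply/eqP; rewrite eqn_leq -{1}(card_ord k) -{2}(card_ord n).
by rewrite (quot_dim_card_le sV sW h Vc ic) (quot_dim_card_le sV sW hk Vb ib).
Qed.

Lemma quot_dim_junk V W : (forall n, ~ quot_dim_is iota V W n) ->
  quot_dim iota V W = 0%N.
Proof. by move=> h; rewrite /quot_dim xgetPN. Qed.

Definition family_rcons n (b : 'I_n -> F) (f : F) : 'I_n.+1 -> F :=
  fun i => if unlift ord_max i is Some j then b j else f.

Lemma lincomb_rcons n (b : 'I_n -> F) (f : F) (c : 'I_n.+1 -> K) :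
  lincomb (family_rcons b f) c =
  lincomb b (fun i => c (lift ord_max i)) + iota (c ord_max) * f.
Proof.
rewrite /lincomb big_ord_recr /= /family_rcons unlift_none; congr (_ + _).
apply: eq_bigr => i _.
rewrite (_ : widen_ord _ i = lift ord_max i) ?liftK //.
by apply: val_inj; rewrite /= /bump leqNgt ltn_ord.
Qed.

Lemma indep_rcons V W n (b : 'I_n -> F) f :
  subspace W -> indep_mod W b -> ~ in_span_mod W b f ->
  indep_mod W (family_rcons b f).
Proof.
move=> sW ib nf c; rewrite lincomb_rcons => Wc.
have c0 : c ord_max = 0.
  apply: contra_notP nf => /eqP c0.
  exists (fun i => - (c ord_max)^-1 * c (lift ord_max i)).
  rewrite (_ : _ - _ = iota (c ord_max)^-1 *
     (lincomb b (fun i => c (lift ord_max i)) + iota (c ord_max) * f)).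
    exact: subspaceZ.
  rewrite mulrDr mulrA -rmorphM mulVf // rmorph1 mul1r addrC; congr (_ + _).
  rewrite /lincomb mulr_sumr -sumrN; apply: eq_bigr => i _.
  by rewrite mulNr rmorphN mulNr opprK rmorphM mulrA.
move: Wc; rewrite c0 rmorph0 mul0r addr0 => /ib h i.
by case: (unliftP ord_max i) => [j|] ->.
Qed.

(** An independent family of maximal size spans, since any vector outside its span could be
    appended. *)
Lemma quot_dim_exists V W N : subspace V -> subspace W ->
  (forall n (b : 'I_n -> F), (forall i, V (b i)) -> indep_mod W b ->
     (n <= N)%N) ->
  exists2 n, (n <= N)%N & quot_dim_is iota V W n.
Proof.
move=> sV sW bnd.
pose Q n := `[< exists b : 'I_n -> F, (forall i, V (b i)) /\ indep_mod W b >].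
have exQ : exists n, Q n.
  by exists 0%N; apply/asboolP; exists (fun _ => 0); split=> [[]|c _ []].
have Qle n : Q n -> (n <= N)%N by move=> /asboolP[b [Vb ib]]; exact: bnd ib.
case: (ex_maxnP exQ Qle) => n /[dup] Qn /asboolP[b [Vb ib]] maxn.
exists n; first exact: Qle.
apply/(quot_dimP _ sV sW); exists b; split=> // f Vf.
apply: contrapT => nf; suff /maxn : Q n.+1 by rewrite ltnn.
apply/asboolP; exists (family_rcons b f); split; last exact: indep_rcons.
by move=> i; rewrite /family_rcons; case: unliftP.
Qed.

(** A basis of W / U followed by lifts of a basis of V / W is a basis of V / U. *)
Lemma quot_dimD U W V m n : subspace U -> subspace W -> subspace V ->
  U `<=` W -> W `<=` V ->
  quot_dim_is iota W U m -> quot_dim_is iota V W n ->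
  quot_dim_is iota V U (m + n).
Proof.
move=> sU sW sV UW WV /(quot_dimP _ sW sU)[b [Wb ib sb]].
move=> /(quot_dimP _ sV sW)[a [Va ia sa]].
pose d i := match fintype.split i with inl j => b j | inr k => a k end.
have lc c : lincomb d c = lincomb b (fun i => c (lshift n i)) +
    lincomb a (fun i => c (rshift m i)).
  rewrite /lincomb big_split_ord; congr (_ + _); apply: eq_bigr => i _.
    by rewrite /d (unsplitK (inl i)).
  by rewrite /d (unsplitK (inr i)).
apply/(quot_dimP _ sV sU); exists d; split.
- by move=> i; rewrite /d; case: fintype.split => j; [apply: WV|].
- move=> c; rewrite lc => Uc.
  have ca : forall i, c (rshift m i) = 0.
    apply: ia.
    rewrite -[lincomb _ _](addKr (lincomb b (fun i => c (lshift n i)))) addrC.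
    by apply: subspaceB => //; [apply: UW|apply: subspace_lincomb].
  have cb : forall i, c (lshift n i) = 0.
    apply: ib; move: Uc; rewrite [X in _ + X]/lincomb big1 ?addr0 // => i _.
    by rewrite ca rmorph0 mul0r.
  by move=> i; case: (split_ordP i) => j ->.
- move=> f /sa[c Wc]; have [c' hc'] := sb _ Wc.
  exists (fun i => match fintype.split i with inl j => c' j | inr k => c k end).
  rewrite lc.
  rewrite (_ : f - _ = f - lincomb a c - lincomb b c') //.
  rewrite [in RHS]addrAC opprD addrA; congr (_ - _ - _); apply: eq_bigr => i _.
    by rewrite (unsplitK (inl i)).
  by rewrite (unsplitK (inr i)).
Qed.

Lemma lincomb_mulr (I : finType) (b : I -> F) c f :
  lincomb (fun i => b i * f) c = lincomb b c * f.
Proof. by rewrite /lincomb mulr_suml; apply: eq_bigr => i _; rewrite mulrA. Qed.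

End LinearAlgebraModSubspace.

(** * Discrete valuations and the ultrametric inequality *)

Section Valuations.
Variables (F : fieldType) (v : F -> int).
Hypothesis hv : discrete_valuation v.

Lemma val0 : v 0 = 0. Proof. by case: hv. Qed.

Lemma valM x y : x != 0 -> y != 0 -> v (x * y) = v x + v y.
Proof. by case: hv => _ h _ _; exact: h. Qed.

Lemma val1 : v 1 = 0.
Proof.
by apply: (@addrI _ (v 1)); rewrite -valM ?oner_neq0 // mulr1 addr0.
Qed.

Lemma valN1 : v (- 1) = 0.
Proof.
have n1 : (- 1 : F) != 0 by rewrite oppr_eq0 oner_neq0.
by move: (valM n1 n1); rewrite mulrNN mulr1 val1; lia.
Qed.

Lemma valN x : v (- x) = v x.
Proof.
have [->|x0] := eqVneq x 0; first by rewrite oppr0.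
by rewrite -mulN1r valM ?oppr_eq0 ?oner_neq0 // valN1 add0r.
Qed.

Lemma valV x : v x^-1 = - v x.
Proof.
have [->|x0] := eqVneq x 0; first by rewrite invr0 val0 oppr0.
apply: (@addrI _ (v x)).
by rewrite -valM ?invr_eq0 // divff // val1 subrr.
Qed.

Lemma valX x n : v (x ^+ n) = v x *+ n.
Proof.
elim: n => [|n IH]; first by rewrite expr0 val1 mulr0n.
have [->|x0] := eqVneq x 0; first by rewrite expr0n val0 mul0rn.
by rewrite exprS valM ?expf_neq0 // IH mulrS.
Qed.

Lemma val_geD n x y : val_ge v n x -> val_ge v n y -> val_ge v n (x + y).
Proof.
case=> [->|hx]; first by rewrite add0r.
case=> [->|hy]; first by rewrite addr0; right.
have [->|x0] := eqVneq x 0; first by rewrite add0r; right.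
have [->|y0] := eqVneq y 0; first by rewrite addr0; right.
have [|xy0] := eqVneq (x + y) 0; first by left.
right; case: hv => _ _ /(_ x y x0 y0 xy0) h _.
by apply: le_trans h; rewrite le_min hx hy.
Qed.

Lemma val_geN n x : val_ge v n x -> val_ge v n (- x).
Proof. by case=> [->|h]; [left; rewrite oppr0 | right; rewrite valN]. Qed.

Lemma val_geM m n x y :
  val_ge v m x -> val_ge v n y -> val_ge v (m + n) (x * y).
Proof.
have [-> _ _|x0] := eqVneq x 0; first by left; rewrite mul0r.
have [-> _ _|y0] := eqVneq y 0; first by left; rewrite mulr0.
case=> [/eqP|hx]; first by rewrite (negbTE x0).
case=> [/eqP|hy]; first by rewrite (negbTE y0).
by right; rewrite valM // lerD.
Qed.

Lemma val_ge_sum n (I : Type) (r : seq I) (Q : pred I) (f : I -> F) :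
  (forall i, Q i -> val_ge v n (f i)) ->
  val_ge v n (\sum_(i <- r | Q i) f i).
Proof.
by move=> h; apply: big_ind => //; [left | exact: val_geD].
Qed.

(** Otherwise the nonzero term of least valuation would be minus a sum of terms of strictly larger
    valuation. *)
Lemma distinct_val_sum0 (I : finType) (f : I -> F) :
  (forall i j, f i != 0 -> f j != 0 -> v (f i) = v (f j) -> i = j) ->
  \sum_i f i = 0 -> forall i, f i = 0.
Proof.
move=> inj_vf sum0 i; apply/eqP/negPn/negP => fi0.
case: (Order.TotalTheory.arg_minP (v \o f) (i0 := i)
  (P := [pred j | f j != 0]) fi0) => j fj0 minj.
have : val_ge v (v (f j) + 1) (f j).
  move: sum0; rewrite (bigD1 j) //= => /eqP; rewrite addr_eq0 => /eqP fjE.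
  rewrite [X in val_ge _ _ X]fjE; apply: val_geN; apply: val_ge_sum => k kj.
  have [->|fk0] := eqVneq (f k) 0; [by left | right].
  rewrite lezD1 lt_neqAle minj // andbT.
  by apply: contra_neq kj => /(inj_vf j k fj0 fk0).
by case=> [/eqP|]; [rewrite (negbTE fj0) | rewrite gerDl].
Qed.

End Valuations.

Section ValuationsOverConstants.
Variables (K F : fieldType) (iota : {rmorphism K -> F}) (P : place iota).

Lemma val_ge_const n a x : val_ge P n x -> val_ge P n (iota a * x).
Proof.
have [-> _|a0] := eqVneq a 0; first by left; rewrite rmorph0 mul0r.
move=> hx; rewrite -[n]add0r; apply: (val_geM (place_valP P)) hx; right.
by rewrite place_const.
Qed.

Lemma val_ge_subspace n : subspace iota [set f | val_ge P n f].
Proof.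
split=> /= [|a x y hx hy]; first by left.
by apply: (val_geD (place_valP P)) => //; apply: val_ge_const.
Qed.

(* The coefficient of each t ^ k is 0 or has valuation 0, so that the nonzero
   terms of a relation have pairwise distinct valuations. *)
Lemma indep_powers (I : finType) (u : I -> F) (t : F) M :
  P t != 0 ->
  (forall c, (exists i, c i != 0) ->
     lincomb iota u c != 0 /\ P (lincomb iota u c) = 0) ->
  indep_mod iota [set 0] (fun p : I * 'I_M => u p.1 * t ^+ p.2).
Proof.
move=> vt0 hu c /= sum0 p.
have t0 : t != 0 by apply: contra_neq vt0 => ->; rewrite (val0 (place_valP P)).
pose U k := lincomb iota u (fun i => c (i, k)).
have sumU : \sum_k U k * t ^+ k = 0.
  rewrite -[RHS]sum0 /lincomb.
  rewrite (eq_bigr (fun p => iota (c (p.1, p.2)) * (u p.1 * t ^+ p.2))).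
    2: by case.
  rewrite -(pair_bigA _ (fun i k => iota (c (i, k)) * (u i * t ^+ k))) /=.
  rewrite exchange_big; apply: eq_bigr => k _.
  by rewrite mulr_suml; apply: eq_bigr => i _; rewrite mulrA.
have UP k : U k = 0 -> forall i, c (i, k) = 0.
  move=> Uk i; apply/eqP/negPn/negP => cik.
  have [|] := hu (fun i => c (i, k)); first by exists i.
  by rewrite -/(U k) Uk eqxx.
case: p => i k; apply: UP.
suff : U k * t ^+ k = 0.
  by move/eqP; rewrite mulf_eq0 expf_eq0 (negbTE t0) andbF orbF => /eqP.
move: k; apply: (distinct_val_sum0 (place_valP P)) sumU => k l.
rewrite !mulf_eq0 !negb_or => /andP[Uk tk] /andP[Ul tl].
have U0 m : U m != 0 -> P (U m) = 0.
  move=> Um; apply: (hu _ _).2.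
  apply: contrapT => nc; case/eqP: Um; rewrite /U /lincomb big1 // => j _.
  suff -> : c (j, m) = 0 by rewrite rmorph0 mul0r.
  by apply/eqP/negPn/negP => cj; apply: nc; exists j.
rewrite !(valM (place_valP P)) // !U0 // !add0r !(valX (place_valP P)).
by move=> e; apply/val_inj => /=; move: vt0 e; nia.
Qed.

End ValuationsOverConstants.

(** * Residue fields are finite-dimensional over K *)

Section FiniteResidueDegree.
Variables (K F : fieldType) (iota : {rmorphism K -> F}).

Lemma indep_bij W (I J : finType) (b : I -> F) (h : J -> I) (k : I -> J) :
  cancel h k -> cancel k h -> indep_mod iota W b ->
  indep_mod iota W (fun j => b (h j)).
Proof.
move=> hk kh ib c Wc j; rewrite -[j]hk; apply: (ib (c \o k)).
rewrite /lincomb (reindex h) /=; last by exists k => i _.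
by under eq_bigr => i _ do rewrite hk.
Qed.

Lemma indep_mulr (I : finType) (b : I -> F) f : f != 0 ->
  indep_mod iota [set 0] b -> indep_mod iota [set 0] (fun i => b i * f).
Proof.
move=> f0 ib c /=; rewrite lincomb_mulr => /eqP.
by rewrite mulf_eq0 (negbTE f0) orbF => /eqP; apply: ib.
Qed.

Variables (x : F) (n : nat) (b : 'I_n -> F).
Hypothesis hx : ~ algebraic_elt iota x.
Hypothesis hb : forall f : F, exists c : 'I_n -> F,
  (forall i, in_simple_ext iota x (c i)) /\ f = \sum_(i < n) c i * b i.

Definition evx (p : {poly K}) : F := (map_poly iota p).[x].

Lemma evxM p r : evx (p * r) = evx p * evx r.
Proof. by rewrite /evx rmorphM hornerM. Qed.

Lemma evx1 : evx 1 = 1.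
Proof. by rewrite /evx rmorph1 hornerC. Qed.

Lemma evxX p k : evx (p ^+ k) = evx p ^+ k.
Proof. by elim: k => [|k IH]; rewrite ?expr0 ?evx1 // !exprS evxM IH. Qed.

Lemma evx_neq0 p : p != 0 -> evx p != 0.
Proof.
by move=> p0; apply: contra_notN hx => /eqP e; exists p => //; apply/eqP.
Qed.

Lemma evx_lincomb N (p : {poly K}) : (size p <= N)%N ->
  evx p = lincomb iota (fun l : 'I_N => x ^+ l) (fun l => p`_l).
Proof.
move=> sp; rewrite /evx (@horner_coef_wide _ N) ?size_map_poly //.
by apply: eq_bigr => i _; rewrite coef_map.
Qed.

(** The product of all denominators clears them at once; A bounds the sizes of the resulting
    numerators uniformly. *)
Lemma common_denominator (J : finType) (a : J -> F) :
  exists (h : {poly K}) (p : J -> 'I_n -> {poly K}) (A : nat),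
    [/\ h != 0, forall j i, (size (p j i) <= A)%N &
     forall j, a j * evx h = \sum_i evx (p j i) * b i].
Proof.
have /choice[c hc] := fun j => hb (a j).
have /choice[pr hpr] : forall ji : J * 'I_n, exists pr : {poly K} * {poly K},
    evx pr.2 != 0 /\ c ji.1 ji.2 = evx pr.1 / evx pr.2.
  by case=> j i; have [/(_ i)[p [r h]] _] := hc j; exists (p, r).
exists (\prod_ji (pr ji).2).
pose p j i := (pr (j, i)).1 * \prod_(ji | ji != (j, i)) (pr ji).2.
exists p, (\max_(ji : J * 'I_n) size (p ji.1 ji.2)); split.
- apply/prodf_neq0 => ji _; have [h _] := hpr ji; apply: contra_neq h => ->.
  by rewrite /evx rmorph0 hornerC.
- by move=> j i; apply: (@leq_bigmax_cond _ xpredT _ (j, i)).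
- move=> j; rewrite {1}(hc j).2 mulr_suml; apply: eq_bigr => i _.
  rewrite (bigD1 (j, i)) //= !evxM mulrAC; congr (_ * _).
  have [r0 ->] := hpr (j, i).
  by rewrite mulrA divfK.
Qed.

(** After multiplication by a common denominator, every product lies in the span of the x ^ l b_i
    with l < A + B. Since A depends on [a] alone, letting M grow gives bounds on |J|. *)
Lemma card_indep_growth (J : finType) (a : J -> F) :
  exists A, forall M B (w : 'I_M -> {poly K}),
    (forall k, (size (w k) <= B)%N) ->
    indep_mod iota [set 0] (fun p : J * 'I_M => a p.1 * evx (w p.2)) ->
    (#|J| * M <= (A + B) * n)%N.
Proof.
have [h [p [A [h0 sp ah]]]] := common_denominator a.
exists A => M B w sw /(indep_mulr (evx_neq0 h0)) iw.
rewrite -[M in X in (X <= _)%N]card_ord -[n]card_ord -[(A + B)%N]card_ord.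
rewrite -!card_prod.
apply: (card_indep_le (subspace_zero iota) iw
  (b := fun li : 'I_(A + B) * 'I_n => x ^+ li.1 * b li.2)) => -[j k] /=.
exists (fun li : 'I_(A + B) * 'I_n => (p j li.2 * w k)`_li.1).
apply/eqP; rewrite subr_eq0.
rewrite mulrAC ah mulr_suml /lincomb.
rewrite -(pair_bigA _ (fun (l : 'I_(A + B)) i =>
  iota (p j i * w k)`_l * (x ^+ l * b i))) /= exchange_big /=.
apply/eqP; apply: eq_bigr => i _.
rewrite mulrAC -evxM (@evx_lincomb (A + B)).
  by rewrite /lincomb mulr_suml; apply: eq_bigr => l _; rewrite mulrA.
apply: leq_trans (size_polyMleq _ _) _.
by apply: leq_trans (leq_pred _) _; apply: leq_add.
Qed.

(* Otherwise the powers 1, t, ..., t^n of a uniformizer t would be linearly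
   independent over K(x). *)
Lemma exists_poly_val_neq0 (P : place iota) :
  exists2 w : {poly K}, w != 0 & P (evx w) <> 0.
Proof.
apply: contrapT => none.
have v0 w : w != 0 -> P (evx w) = 0.
  by move=> w0; apply: contrapT => h; apply: none; exists w.
have [_ _ _ [t t0 vt]] := place_valP P.
have [A hA] := card_indep_growth (fun k : 'I_n.+1 => t ^+ k).
(* With n + 1 powers of t, the growth bound reads (n + 1) M <= (A + M) n, that is M <= A n. *)
pose M := (A * n).+1.
have /(hA _ M) : forall k : 'I_M, (size ('X^k : {poly K}) <= M)%N.
  by move=> k; rewrite size_polyXn.
rewrite card_ord => h; suff /h : indep_mod iota [set 0]
    (fun p : 'I_n.+1 * 'I_M => t ^+ p.1 * evx 'X^(p.2)).
  by rewrite /M; nia.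
have swK (S T : Type) : cancel (fun p : S * T => (p.2, p.1))
                               (fun p : T * S => (p.2, p.1)) by case.
have vt1 : P t != 0 by rewrite vt.
have := indep_powers (M := n.+1) (u := fun l : 'I_M => x ^+ l) vt1.
move=> /(_ _)/(indep_bij (swK _ _) (swK _ _)) hi.
rewrite (_ : (fun p => _) =
  (fun p : 'I_n.+1 * 'I_M => x ^+ (p.2, p.1).1 * t ^+ (p.2, p.1).2)).
  apply: hi => c [i ci].
  (* A combination of powers of x is a polynomial value, and by [v0] all nonzero ones have valuation
     0, as [indep_powers] requires. *)
  pose p := \poly_(l < M) (if insub l is Some j then c j else 0).
  have pc (l : 'I_M) : p`_l = c l by rewrite coef_poly ltn_ord valK.
  have -> : lincomb iota (fun l : 'I_M => x ^+ l) c = evx p.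
    rewrite (@evx_lincomb M) ?size_poly // /lincomb.
    by apply: eq_bigr => l _; rewrite pc.
  have p0 : p != 0 by apply: contra_neq ci => p0; rewrite -pc p0 coef0.
  by split; [apply: evx_neq0 | apply: v0].
apply/funext => -[k l] /=; rewrite mulrC; congr (_ * _).
by rewrite /evx map_polyXn hornerXn.
Qed.

(** A nontrivial combination lies in O_P but not in m_P. This is the hypothesis of
    [indep_powers]. *)
Lemma residue_indep_val0 (P : place iota) (I : finType) (u : I -> F) :
  (forall i, val_ge P 0 (u i)) -> indep_mod iota [set f | val_ge P 1 f] u ->
  forall c, (exists i, c i != 0) ->
    lincomb iota u c != 0 /\ P (lincomb iota u c) = 0.
Proof.
move=> u0 iu c [i ci]; have nge : ~ val_ge P 1 (lincomb iota u c).
  by move=> /iu/(_ i)/eqP; rewrite (negbTE ci).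
have : val_ge P 0 (lincomb iota u c).
  exact: (subspace_lincomb c (val_ge_subspace P 0)).
case=> [e|h]; first by case: nge; left.
split; first by apply/eqP => e; apply: nge; left.
apply/eqP; rewrite eq_le h andbT leNgt; apply/negP => h1; apply: nge; right.
by move: h1; lia.
Qed.

(* For M large, the |I| M products u_i w(x) ^ k with k < M do not fit into the
   span of the x ^ l b_j with l < A + M size w. *)
Lemma residue_card_bound (P : place iota) :
  exists N, forall (I : finType) (u : I -> F), (forall i, val_ge P 0 (u i)) ->
    indep_mod iota [set f | val_ge P 1 f] u -> (#|I| <= N)%N.
Proof.
have [w w0 vw] := exists_poly_val_neq0 P.
exists (size w * n)%N => I u u0 iu.
have [A hA] := card_indep_growth u.
have iw M : indep_mod iota [set 0] (fun p : I * 'I_M => u p.1 * evx (w ^+ p.2)).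
  rewrite (_ : (fun p => _) = (fun p : I * 'I_M => u p.1 * evx w ^+ p.2)).
    2: by apply/funext => p; rewrite evxX.
  by apply: (indep_powers (P := P)); [exact/eqP | apply: residue_indep_val0].
have sw M (k : 'I_M) : (size (w ^+ k) <= size w * M)%N.
  apply: leq_trans (size_poly_exp_leq _ _) _.
  by have := ltn_ord k; move: w0; rewrite -size_poly_gt0; nia.
(* For M = A n + 1 this gives |I| M <= (A + size w M) n; if |I| > size w n, then M <= A n would
   follow. *)
have := hA _ _ _ (sw (A * n).+1) (iw _).
by nia.
Qed.

End FiniteResidueDegree.

Section DegreeOfPlace.
Variables (K F : fieldType) (iota : {rmorphism K -> F}).
Hypothesis hF : function_field iota.
Variable P : place iota.

(** Certifies that [deg_place P] is a true dimension and not the default value of [quot_dim]. *)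
Lemma deg_place_is :
  quot_dim_is iota [set f | val_ge P 0 f] [set f | val_ge P 1 f] (deg_place P).
Proof.
have [x [hx [n [b hb]]]] := hF.
have [N hN] := residue_card_bound hx hb P.
have [k|k _ hk] := @quot_dim_exists _ _ iota _ _ N
  (val_ge_subspace P 0) (val_ge_subspace P 1).
  by move=> u u0 /(hN _ u u0); rewrite card_ord.
by rewrite /deg_place (quot_dimE _ _ hk) //; apply: val_ge_subspace.
Qed.

Lemma deg_place_gt0 : (0 < deg_place P)%N.
Proof.
have := @quot_dim_card_le _ _ iota _ _ _ 'I_1 (fun _ => 1)
  (val_ge_subspace P 0) (val_ge_subspace P 1) deg_place_is.
rewrite card_ord; apply => [_|c].
  by right; rewrite (val1 (place_valP P)).
rewrite /lincomb big_ord1 mulr1 /= => h i; rewrite ord1; move: h.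
have [->//|c0] := eqVneq (c ord0) 0.
case=> [/eqP|]; last by rewrite place_const.
by rewrite fmorph_eq0 (negbTE c0).
Qed.

End DegreeOfPlace.

(** * Divisors and their degrees *)

Section Divisors.
Variables (K F : fieldType) (iota : {rmorphism K -> F}).
Implicit Types (P Q : place iota) (D E : place iota -> int).

Lemma divisor_support D : is_divisor D ->
  exists2 r : seq (place iota), uniq r & forall P, P \notin r -> D P = 0.
Proof.
move=> /finite_seqP[r rE]; exists (undup r); first exact: undup_uniq.
move=> P; rewrite mem_undup => Pr; apply: contrapT => DP.
have : [set` r] P by rewrite -rE /=; apply/eqP.
by rewrite /= (negbTE Pr).
Qed.

(** The list may be larger than the support, so two divisors can be summed over a common list. *)
Lemma deg_divisorE D (r : seq (place iota)) : uniq r ->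
  (forall P, P \notin r -> D P = 0) ->
  deg_divisor D = \sum_(P <- r) D P * (deg_place P)%:Z.
Proof.
move=> ur h; rewrite /deg_divisor (@fsbigE _ _ _ _ _ r) //.
  by apply: eq_bigl => P; rewrite in_setT.
by move=> P _ /h ->; rewrite mul0r.
Qed.

Lemma is_divisor_seq D (r : seq (place iota)) :
  (forall P, P \notin r -> D P = 0) -> is_divisor D.
Proof.
move=> h; apply: (@sub_finite_set _ _ [set` r]); last exact: finite_seq.
by move=> P /=; apply: contra_neqT => /h.
Qed.

Lemma is_divisorD D E : is_divisor D -> is_divisor E -> is_divisor (D \+ E).
Proof.
move=> /divisor_support[r _ hr] /divisor_support[t _ ht].
apply: (@is_divisor_seq _ (r ++ t)) => P.
by rewrite mem_cat negb_or => /andP[/hr /= -> /ht ->].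
Qed.

Lemma is_divisorN D : is_divisor D -> is_divisor (\- D).
Proof.
move=> /divisor_support[r _ hr].
by apply: (@is_divisor_seq _ r) => P /hr /= ->; rewrite oppr0.
Qed.

Lemma is_divisor_place_mul P n : is_divisor (place_mul P n).
Proof.
apply: (@is_divisor_seq _ [:: P]) => Q.
by rewrite inE /place_mul => /negbTE ->.
Qed.

Lemma deg_divisorD D E : is_divisor D -> is_divisor E ->
  deg_divisor (D \+ E) = deg_divisor D + deg_divisor E.
Proof.
move=> /divisor_support[r _ hr] /divisor_support[t _ ht].
pose w := undup (r ++ t).
have wr P : P \notin w -> D P = 0.
  by rewrite mem_undup mem_cat negb_or => /andP[/hr].
have wt P : P \notin w -> E P = 0.
  by rewrite mem_undup mem_cat negb_or => /andP[_ /ht].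
rewrite !(@deg_divisorE _ w) ?undup_uniq //.
  by rewrite -big_split; apply: eq_bigr => P _; rewrite /= mulrDl.
by move=> P Pw /=; rewrite wr // wt.
Qed.

Lemma deg_divisor0 : deg_divisor (fun _ : place iota => 0) = 0.
Proof. by rewrite (@deg_divisorE _ [::]) // big_nil. Qed.

Lemma deg_divisorN D : is_divisor D -> deg_divisor (\- D) = - deg_divisor D.
Proof.
move=> dD; apply: (@addrI _ (deg_divisor D)).
rewrite -deg_divisorD ?subrr //; last exact: is_divisorN.
rewrite -deg_divisor0; congr deg_divisor.
by apply/funext => P /=; rewrite subrr.
Qed.

Lemma deg_place_mul P n : deg_divisor (place_mul P n) = n * (deg_place P)%:Z.
Proof.
rewrite (@deg_divisorE _ [:: P]) ?big_seq1 //; first by rewrite /place_mul eqxx.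
by move=> Q; rewrite inE /place_mul => /negbTE ->.
Qed.

Lemma is_divisor_sum (I : Type) (r : seq I) (f : I -> place iota -> int) :
  (forall i, is_divisor (f i)) -> is_divisor (fun P => \sum_(i <- r) f i P).
Proof.
move=> df; elim: r => [|i r IH].
  by apply: (@is_divisor_seq _ [::]) => P _; rewrite big_nil.
rewrite (_ : (fun P => _) = f i \+ (fun P => \sum_(j <- r) f j P)).
  exact: is_divisorD.
by apply/funext => P; rewrite big_cons.
Qed.

Lemma deg_divisor_sum (I : Type) (r : seq I) (f : I -> place iota -> int) :
  (forall i, is_divisor (f i)) ->
  deg_divisor (fun P => \sum_(i <- r) f i P) = \sum_(i <- r) deg_divisor (f i).
Proof.
move=> df; elim: r => [|i r IH].
  rewrite big_nil -[RHS]deg_divisor0; congr deg_divisor.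
  by apply/funext => P; rewrite big_nil.
rewrite big_cons -IH -deg_divisorD //; last exact: is_divisor_sum.
by congr deg_divisor; apply/funext => P; rewrite big_cons.
Qed.

Lemma divisor_place_sum D (r : seq (place iota)) : uniq r ->
  (forall P, P \notin r -> D P = 0) ->
  D = fun Q => \sum_(P <- r) place_mul P (D P) Q.
Proof.
move=> ur h; apply/funext => Q.
have [Qr|Qr] := boolP (Q \in r).
  rewrite (bigD1_seq Q) //= big1 ?addr0; first by rewrite /place_mul eqxx.
  by move=> P PQ; rewrite /place_mul eq_sym (negbTE PQ).
rewrite h // big_seq big1 // => P Pr; rewrite /place_mul; case: eqP => // QP.
by rewrite QP Pr in Qr.
Qed.

End Divisors.

(** * Riemann-Roch spaces and the growth of their dimension *)

Section RiemannRochSpaces.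
Variables (K F : fieldType) (iota : {rmorphism K -> F}).
Implicit Types (P Q : place iota) (D E : place iota -> int).

(** Moving the exception for 0 inside the quantifier presents L(D) as an intersection of subspaces,
    one per place. *)
Lemma RR_val_ge D f : RR_space D f <-> forall P, val_ge P (- D P) f.
Proof.
split=> [[->|h] P|h]; first by left.
  by right; rewrite lerNl -subr_ge0 opprK addrC; apply: h.
have [->|f0] := eqVneq f 0; first by left.
right=> P; case: (h P) => [/eqP|]; first by rewrite (negbTE f0).
by rewrite lerNl -subr_ge0 opprK addrC.
Qed.

Lemma RR_subspace D : subspace iota (RR_space D).
Proof.
split=> [|a x y /RR_val_ge hx /RR_val_ge hy]; first by left.
apply/RR_val_ge => P.
by apply: (val_ge_subspace P (- D P)).2; [apply: hx | apply: hy].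
Qed.

Lemma RR_le D E f : (forall P, D P <= E P) -> RR_space D f -> RR_space E f.
Proof.
move=> DE [->|h]; [by left|right] => P.
by apply: le_trans (h P) _; rewrite lerD2l.
Qed.

Lemma RR_mul D E f h : RR_space D f -> RR_space E h ->
  RR_space (D \+ E) (f * h).
Proof.
move=> /RR_val_ge hf /RR_val_ge hh; apply/RR_val_ge => P /=.
by rewrite opprD; apply: (val_geM (place_valP P)).
Qed.

Lemma RR_exp D f k : RR_space D f -> RR_space (fun P => D P *+ k) (f ^+ k).
Proof.
move=> Df; elim: k => [|k IH].
  by right=> P; rewrite expr0 (val1 (place_valP P)) mulr0n.
rewrite exprS (_ : (fun P => _) = D \+ (fun P => D P *+ k)).
  exact: RR_mul.
by apply/funext => P; rewrite mulrS.
Qed.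

Lemma val_surj P (n : int) : exists2 t : F, t != 0 & P t = n.
Proof.
have [_ _ _ [t t0 vt]] := place_valP P.
case: n => n.
  exists (t ^+ n); first by rewrite expf_neq0.
  by rewrite (valX (place_valP P)) vt natz.
exists ((t ^+ n.+1)^-1); first by rewrite invr_eq0 expf_neq0.
by rewrite (valV (place_valP P)) (valX (place_valP P)) vt natz NegzE.
Qed.

Definition fin_RR D := exists n, quot_dim_is iota (RR_space D) [set 0] n.

Lemma ell_is D : fin_RR D ->
  quot_dim_is iota (RR_space D) [set 0] (ell D).
Proof.
case=> n hn; rewrite /ell (quot_dimE _ _ hn) //; first exact: RR_subspace.
exact: subspace_zero.
Qed.

Lemma ell_card_le D (I : finType) (b : I -> F) : fin_RR D ->
  (forall i, RR_space D (b i)) -> indep_mod iota [set 0] b -> (#|I| <= ell D)%N.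
Proof.
move=> /ell_is h; apply: quot_dim_card_le h; first exact: RR_subspace.
exact: subspace_zero.
Qed.

(** Multiplication by f is injective and K-linear, so independent families of L(D) go to independent
    families of L(E). *)
Lemma ell_le_mul D E f : f != 0 ->
  (forall h, RR_space D h -> RR_space E (h * f)) ->
  fin_RR E -> fin_RR D /\ (ell D <= ell E)%N.
Proof.
move=> f0 DE fE.
have [n nE hn] : exists2 n, (n <= ell E)%N &
    quot_dim_is iota (RR_space D) [set 0] n.
  apply: quot_dim_exists; [exact: RR_subspace | exact: subspace_zero|].
  move=> n b Db ib; rewrite -[n]card_ord.
  apply: (ell_card_le (b := fun i => b i * f)) => //; last exact: indep_mulr.
  by move=> i; apply: DE.
have fD : fin_RR D by exists n.
split=> //; rewrite (_ : ell D = n) //.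
by apply: quot_dimE hn; [exact: RR_subspace | exact: subspace_zero].
Qed.

Lemma ell_le D E : (forall P, D P <= E P) -> fin_RR E ->
  fin_RR D /\ (ell D <= ell E)%N.
Proof.
move=> DE; apply: (@ell_le_mul _ _ 1); first exact: oner_neq0.
by move=> h; rewrite mulr1; apply: RR_le.
Qed.

Hypothesis hF : function_field iota.

Lemma RR_add_place D P : fin_RR D ->
  fin_RR (D \+ place_mul P 1) /\
  (ell (D \+ place_mul P 1) <= ell D + deg_place P)%N.
Proof.
set E := D \+ _ => fD.
have DE Q : D Q <= E Q by rewrite /E /= lerDl /place_mul; case: ifP.
(* Multiplication by t sends L(D + P) into O_P, and what lands in m_P comes from L(D); so L(D + P) /
   L(D) embeds into the residue field. *)
have [t t0 vt] := val_surj P (D P + 1).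
have [n nP hn] : exists2 n, (n <= deg_place P)%N &
    quot_dim_is iota (RR_space E) (RR_space D) n.
  apply: quot_dim_exists; [exact: RR_subspace | exact: RR_subspace|].
  move=> n b Eb ib; rewrite -[n]card_ord.
  have vbt m f : val_ge P m f -> val_ge P (m + (D P + 1)) (f * t).
    by move=> hf; apply: (val_geM (place_valP P)) => //; right; rewrite vt.
  apply: (quot_dim_card_le _ _ (deg_place_is hF P) (a := fun i => b i * t)).
  - exact: val_ge_subspace.
  - exact: val_ge_subspace.
  - move=> i; have /RR_val_ge/(_ P)/vbt := Eb i.
    by rewrite /E /= /place_mul eqxx addNr.
  - move=> c /= hc; apply: ib.
    apply/RR_val_ge => Q; have [->|QP] := eqVneq Q P; last first.
      have /RR_val_ge/(_ Q) := subspace_lincomb c (RR_subspace E) Eb.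
      by rewrite /E /= /place_mul (negbTE QP) addr0.
    move: hc; rewrite lincomb_mulr.
    move=> hc; rewrite -[lincomb _ _ _](mulfK t0).
    rewrite (_ : - D P = 1 + - (D P + 1)); last by lia.
    apply: (val_geM (place_valP P)) => //; right.
    by rewrite (valV (place_valP P)) vt.
have hE : quot_dim_is iota (RR_space E) [set 0] (ell D + n).
  apply: quot_dimD (ell_is fD) hn; [exact: subspace_zero | exact: RR_subspace
    | exact: RR_subspace | by move=> _ -> ; left | by move=> f; apply: RR_le].
split; first by exists (ell D + n)%N.
rewrite (_ : ell E = ell D + n)%N ?leq_add2l //.
by apply: quot_dimE hE; [exact: RR_subspace | exact: subspace_zero].
Qed.

Lemma RR_add_places D P n : fin_RR D ->
  fin_RR (D \+ place_mul P n%:Z) /\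
  (ell (D \+ place_mul P n%:Z) <= ell D + n * deg_place P)%N.
Proof.
move=> fD; elim: n => [|n [fn ln]].
  rewrite (_ : _ \+ _ = D); first by rewrite mul0n addn0.
  by apply/funext => Q; rewrite /= /place_mul; case: ifP; rewrite addr0.
rewrite (_ : _ \+ _ = (D \+ place_mul P n%:Z) \+ place_mul P 1).
  have [? le1] := RR_add_place P fn; split=> //.
  by apply: leq_trans le1 _; rewrite mulSn; lia.
apply/funext => Q; rewrite /= /place_mul.
case: ifP => _; last by rewrite !addr0.
by rewrite -addrA -natz -addn1 natrD !natz.
Qed.

(** E - D is effective and is added to D one place of its support at a time, each multiple n P
    costing at most n deg P. *)
Lemma ell_le_deg D E : is_divisor D -> is_divisor E ->
  (forall P, D P <= E P) -> fin_RR D ->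
  fin_RR E /\ (ell E)%:Z <= (ell D)%:Z + deg_divisor E - deg_divisor D.
Proof.
move=> dD dE DE fD.
have dZ : is_divisor (E \- D) by apply: is_divisorD => //; apply: is_divisorN.
have Z0 P : 0 <= (E \- D) P by rewrite /= subr_ge0.
have EZ : E = D \+ (E \- D) by apply/funext => P; rewrite /= addrC subrK.
move: (E \- D) dZ Z0 EZ => Z dZ Z0 ->.
rewrite deg_divisorD // addrA [_ + deg_divisor D]addrC -addrA.
rewrite addrAC subrr add0r.
have [r ur hr] := divisor_support dZ.
rewrite (divisor_place_sum ur hr).
rewrite deg_divisor_sum; last by move=> P; apply: is_divisor_place_mul.
elim: r {ur hr} => [|P r [fr lr]].
  rewrite big_nil addr0 (_ : _ \+ _ = D) //.
  by apply/funext => Q; rewrite /= big_nil addr0.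
have [n En] : exists n : nat, Z P = n%:Z by exists `|Z P|%N; rewrite gez0_abs.
have [f1 l1] := RR_add_places P n fr.
rewrite (_ : D \+ _ = (D \+ (fun Q => \sum_(P <- r) place_mul P (Z P) Q))
  \+ place_mul P n%:Z).
  split=> //; rewrite big_cons En deg_place_mul.
  move: l1 lr; rewrite -lez_nat !PoszD PoszM => l1 lr.
  by apply: le_trans l1 _; rewrite [X in _ <= _ + X]addrC addrA lerD2r.
by apply/funext => Q; rewrite /= big_cons En addrCA [RHS]addrC.
Qed.

End RiemannRochSpaces.

(** * Consequences of the Riemann bound *)

Section Genus.
Variables (K F : fieldType) (iota : {rmorphism K -> F}).
Hypothesis hF : function_field iota.
Hypothesis hK : full_constant_field iota.
Variable g : nat.
Hypothesis hg : genus_is iota g.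
Variable Pinf : place iota.
Implicit Types (P Q : place iota) (D E : place iota -> int).

Lemma riemann_ineq D : is_divisor D -> deg_divisor D + 1 - g%:Z <= (ell D)%:Z.
Proof. by move=> /(hg.1 D); lia. Qed.

(* Otherwise ell (n Pinf) would be the junk value 0 of [quot_dim] for all n. *)
Lemma fin_RR0 : fin_RR (fun _ : place iota => 0).
Proof.
apply: contrapT => nf.
(* The bound for g Pinf is g deg Pinf + 1 - g >= 1, against the default value 0. *)
have := riemann_ineq (is_divisor_place_mul Pinf g%:Z).
rewrite deg_place_mul /ell quot_dim_junk => [|n hn].
  by have := deg_place_gt0 hF Pinf; nia.
have le0 P : 0 <= place_mul Pinf g%:Z P by rewrite /place_mul; case: ifP.
by apply: nf; have [] := ell_le le0; first by exists n.
Qed.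

(** L(D) is contained in L(max(D, 0)), and max(D, 0) is reached from 0 by adding places. *)
Lemma fin_RR_divisor D : is_divisor D -> fin_RR D.
Proof.
move=> dD; pose E := fun P => Num.max (D P) 0.
have dE : is_divisor E.
  have [r _ hr] := divisor_support dD.
  by apply: (@is_divisor_seq _ _ _ _ r) => P /hr DP; rewrite /E DP maxxx.
have d0 : is_divisor (fun _ : place iota => 0 : int).
  exact: (@is_divisor_seq _ _ _ _ [::]).
have E0 P : 0 <= E P by rewrite /E le_max lexx orbT.
have DE P : D P <= E P by rewrite /E le_max lexx.
have [fE _] := ell_le_deg hF d0 dE E0 fin_RR0.
by have [] := ell_le DE fE.
Qed.

(** All powers of f lie in the finite-dimensional L(0); a relation among them makes f algebraic over
    K, hence constant. *)
Lemma RR0_const f : RR_space (fun _ : place iota => 0) f ->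
  exists a, f = iota a.
Proof.
move=> f0; apply: hK.
pose N := ell (fun _ : place iota => 0 : int).
have : ~ indep_mod iota [set 0] (fun k : 'I_N.+1 => f ^+ k).
  move=> /(ell_card_le fin_RR0); rewrite card_ord ltnn => h; apply/notF/h => k.
  by have := RR_exp k f0; congr RR_space; apply/funext => P; rewrite mul0rn.
move=> /existsNP[c /not_implyP[/= c0 /existsNP[i /eqP ci]]].
pose p := \poly_(l < N.+1) (if insub l is Some j then c j else 0).
have pc (l : 'I_N.+1) : p`_l = c l by rewrite coef_poly ltn_ord valK.
exists p; first by apply: contra_neq ci => p0; rewrite -pc p0 coef0.
apply/rootP; rewrite -{}[RHS]c0 (@horner_coef_wide _ N.+1).
  by apply: eq_bigr => l _; rewrite coef_map /= pc.
by rewrite size_map_poly size_poly.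
Qed.

Lemma ell0_le1 : (ell (fun _ : place iota => 0) <= 1)%N.
Proof.
have /(quot_dimP _ (RR_subspace _) (subspace_zero iota))[b [Vb ib _]] :=
  ell_is fin_RR0.
rewrite -[X in (X <= _)%N]card_ord -[1%N]card_ord.
apply: (card_indep_le (subspace_zero iota) ib (b := fun _ : 'I_1 => 1)) => i.
have [a ->] := RR0_const (Vb i); exists (fun=> a).
by rewrite /lincomb big_ord1 mulr1 subrr.
Qed.

(* Multiplication by f ^ k embeds L(- k D) into L(0). *)
Lemma deg_ge0_RR D f : is_divisor D -> f != 0 -> RR_space D f ->
  0 <= deg_divisor D.
Proof.
move=> dD f0 Df; rewrite leNgt; apply/negP => ltD0.
(* With g + 1 copies the degree is at least g + 1, so the Riemann bound gives [ell E] >= 2, against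
   [ell0_le1]. *)
pose E := fun P => \sum_(i < g.+1) (\- D) P.
have dND := is_divisorN dD.
have dE : is_divisor E by apply: is_divisor_sum.
have fE h : RR_space E h ->
      RR_space (fun _ : place iota => 0) (h * f ^+ g.+1).
  move=> Eh; have := RR_mul Eh (RR_exp g.+1 Df).
  rewrite (_ : E \+ _ = (fun=> 0)) //; apply/funext => P.
  by rewrite /= /E sumr_const card_ord mulNrn addNr.
have [_ leE] := ell_le_mul (expf_neq0 g.+1 f0) fE fin_RR0.
have := riemann_ineq dE.
rewrite deg_divisor_sum // sumr_const card_ord deg_divisorN // -mulr_natr.
by move: (leq_trans leE ell0_le1) ltD0; nia.
Qed.

Lemma ell_gt0P D : is_divisor D -> (0 < ell D)%N ->
  exists2 f, f != 0 & RR_space D f.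
Proof.
move=> dD; have /(quot_dimP _ (RR_subspace _) (subspace_zero iota)) :=
  ell_is (fin_RR_divisor dD).
case=> b [Vb ib _] lt0; exists (b (Ordinal lt0)); last exact: Vb.
apply/eqP => b0; have := ib (fun i => (i == Ordinal lt0)%:R) _ (Ordinal lt0).
rewrite eqxx /= => h; suff /h/eqP : [set 0] (lincomb iota b
    (fun i => (i == Ordinal lt0)%:R)) by rewrite oner_eq0.
rewrite /lincomb /= big1 // => i _.
by case: eqP => [->|_]; rewrite ?b0 ?mulr0 // rmorph0 mul0r.
Qed.

Lemma ell_neg D : is_divisor D -> deg_divisor D < 0 -> ell D = 0%N.
Proof.
move=> dD lt0; apply/eqP; rewrite -leqn0 leqNgt; apply/negP.
move=> /(ell_gt0P dD)[f].
by move=> f0 /(deg_ge0_RR dD f0); rewrite leNgt lt0.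
Qed.

(** Outside the support of D, f has no poles, so P f != 0 means a zero. Subtracting more than |deg
    D| such zeros from D keeps f in the space but makes the degree negative. *)
Lemma is_divisor_div D f : is_divisor D -> f != 0 -> RR_space D f ->
  is_divisor (fun P : place iota => P f).
Proof.
move=> dD f0 Df; apply: contrapT => infS.
pose A := [set P : place iota | P f != 0] `\` [set P | D P != 0].
have [r [ur rA cr]] : exists r : seq (place iota), [/\ uniq r,
    forall P, P \in r -> A P & (`|deg_divisor D| < size r)%N].
  have /(infinite_set_fset `|deg_divisor D|.+1)[B BA cB] : infinite_set A.
    exact: infinite_setD.
  by exists (finmap.enum_fset B); split=> //; apply: finmap.fset_uniq.
pose E := fun P => \sum_(Q <- r) place_mul Q (- 1) P.
have dE : is_divisor E.
  by apply: is_divisor_sum => Q; apply: is_divisor_place_mul.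
have : RR_space (D \+ E) f.
  right=> P; case: Df => [/eqP|/(_ P) Df]; first by rewrite (negbTE f0).
  rewrite /= addrA; have [Pr|Pr] := boolP (P \in r); last first.
    rewrite /E big_seq big1 ?addr0 // => Q Qr; rewrite /place_mul.
    by case: eqP => // PQ; rewrite PQ Qr in Pr.
  have [/= Pf0 /negP/negPn/eqP DP] := rA P Pr.
  have -> : E P = - 1.
    rewrite /E (bigD1_seq P) //= big1 => [|Q QP].
      by rewrite /place_mul eqxx addr0.
    by rewrite /place_mul eq_sym (negbTE QP).
  by move: Df Pf0; rewrite DP; lia.
move=> /(deg_ge0_RR (is_divisorD dD dE) f0); rewrite deg_divisorD //.
rewrite deg_divisor_sum; last by move=> Q; apply: is_divisor_place_mul.
have : \sum_(Q <- r) deg_divisor (place_mul Q (- 1)) <= \sum_(Q <- r) (- 1).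
  apply: ler_sum => Q _; rewrite deg_place_mul.
  by have := deg_place_gt0 hF Q; lia.
rewrite big_const_seq count_predT iter_addr_0 mulNrn natz => le1.
rewrite -(lerD2l (deg_divisor D)) in le1 => /le_trans/(_ le1).
by move: cr; lia.
Qed.

(** f lies in L(- div f), whose degree is therefore nonnegative. *)
Lemma deg_div_le0 f : f != 0 -> is_divisor (fun P : place iota => P f) ->
  deg_divisor (fun P : place iota => P f) <= 0.
Proof.
move=> f0 df; rewrite -oppr_ge0 -deg_divisorN //.
apply: (deg_ge0_RR (is_divisorN df) f0).
by right=> P /=; rewrite subrr.
Qed.

(* For large n a translate of D + n Pinf by a principal divisor dominates a
   divisor at which the Riemann bound is attained. *)
Lemma ell_eventually_le D : is_divisor D -> exists N : nat, forall n : nat,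
  (N <= n)%N ->
  (ell (D \+ place_mul Pinf n%:Z))%:Z <=
    deg_divisor (D \+ place_mul Pinf n%:Z) + 1 - g%:Z.
Proof.
move=> dD; have [_ [D0 [dD0 gD0]]] := hg.
(* From this n on, D1 - D0 has degree at least g, so the Riemann bound provides a nonzero f in L(D1
   - D0). *)
exists `|(g%:Z + deg_divisor D0 - deg_divisor D)%R|%N => n leN.
set D1 := D \+ _.
have dD1 : is_divisor D1.
  by apply: is_divisorD => //; apply: is_divisor_place_mul.
have dX : is_divisor (D1 \- D0) by apply: is_divisorD => //; apply: is_divisorN.
have [||f f0 Xf] := @ell_gt0P (D1 \- D0) => //.
  have := riemann_ineq dX.
  rewrite deg_divisorD ?deg_divisorN //; last exact: is_divisorN.
  rewrite deg_divisorD ?deg_place_mul //; last exact: is_divisor_place_mul.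
  by have := deg_place_gt0 hF Pinf; nia.
have df := is_divisor_div dX f0 Xf.
(* D2 >= D0 by choice of f, deg D2 <= deg D1, and division by f embeds L(D1) into L(D2). Hence ell
   D1 <= ell D0 + deg D2 - deg D0 <= deg D1 + 1 - g. *)
pose D2 := D1 \+ (fun P : place iota => P f).
have dD2 : is_divisor D2 by apply: is_divisorD.
have D02 P : D0 P <= D2 P.
  case: Xf => [/eqP|/(_ P)]; first by rewrite (negbTE f0).
  by rewrite /D2 /=; lia.
have [fD2 le2] := ell_le_deg hF dD0 dD2 D02 (fin_RR_divisor dD0).
have D12 h : RR_space D1 h -> RR_space D2 (h * f^-1).
  move=> Dh; apply: RR_mul => //.
  by right=> P; rewrite (valV (place_valP P)) addNr.
have [_ le1] := ell_le_mul (invr_neq0 f0) D12 fD2.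
move: le2; rewrite {2}/D2 deg_divisorD //.
by have := deg_div_le0 f0 df; lia.
Qed.

End Genus.

(** * Jumps of dimension and exact pole orders *)

Section StrictInclusions.
Variables (K F : fieldType) (iota : {rmorphism K -> F}).
Implicit Types (P Q : place iota) (D E : place iota -> int).

Lemma ell_lt_exists D E : fin_RR D -> (ell D < ell E)%N ->
  exists2 f, RR_space E f & ~ RR_space D f.
Proof.
move=> fD lt; apply: contrapT => no; move: lt; apply/negP; rewrite -leqNgt.
have ED h : RR_space E h -> RR_space D (h * 1).
  by rewrite mulr1 => Eh; apply: contrapT => nD; apply: no; exists h.
by have [] := ell_le_mul (oner_neq0 F) ED fD.
Qed.

Lemma ell_lt D E f : (forall P, D P <= E P) -> fin_RR D -> fin_RR E ->
  RR_space E f -> ~ RR_space D f -> (ell D < ell E)%N.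
Proof.
move=> DE fD fE Ef nDf.
have /(quot_dimP _ (RR_subspace _) (subspace_zero iota))[b [Db ib _]] :=
  ell_is fD.
rewrite -[(ell D).+1]card_ord.
apply: (ell_card_le (b := family_rcons b f)) => // [i|].
  by rewrite /family_rcons; case: unliftP => // j _; apply: RR_le (Db j).
apply: (@indep_rcons _ _ iota (RR_space D)) => //; first exact: subspace_zero.
case=> c /eqP; rewrite subr_eq0 => /eqP fE'; apply: nDf.
by rewrite fE'; apply: subspace_lincomb => //; apply: RR_subspace.
Qed.

(** The two spaces differ only in the condition at P, and there by one. *)
Lemma RR_val_exact D P (n : int) f :
  RR_space (D \+ place_mul P n) f -> ~ RR_space (D \+ place_mul P (n - 1)) f ->
  f != 0 /\ P f = - (D P + n).
Proof.
move=> Ef nDf; have f0 : f != 0 by apply: contra_notN nDf => /eqP ->; left.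
split=> //; case: Ef => [/eqP|Ef]; first by rewrite (negbTE f0).
apply: contrapT => ne; apply: nDf; right=> Q; move: (Ef Q).
rewrite /= /place_mul; case: eqP => [->|//].
by move: (Ef P) ne; rewrite /= /place_mul eqxx; lia.
Qed.

End StrictInclusions.

(* A and B count jumps; a position M without A-jump pairs every B-jump l with
   the non-A-jump M - l. *)
Lemma jump_count (A B : nat -> nat) (g : nat) :
  B 0%N = 0%N -> (forall i, (B i <= B i.+1 <= (B i).+1)%N) ->
  (forall i, (A i <= A i.+1 <= (A i).+1)%N) ->
  (forall i, (i <= B i + g)%N) -> (forall i, (i <= A i + g)%N) ->
  (forall i l, (A i < A i.+1)%N -> (B l < B l.+1)%N ->
     (A (i + l) < A (i + l).+1)%N) ->
  A 0%N = 0%N ->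
  forall M, (2 * g <= M)%N -> (A M < A M.+1)%N.
Proof.
move=> B0 stepB stepA leB leA mulAB A0 M leM.
rewrite ltnNge; apply/negP => eqM.
(* Among the top j positions up to M there are at most j - B j A-jumps, since l and M - l are never
   a B-jump and an A-jump together. At j = M + 1 the bounds by g then give M + 1 <= 2 g. *)
have cnt j : (j <= M.+1 -> A M.+1 + B j <= j + A (M.+1 - j))%N.
  elim: j => [|j IH] lej; first by rewrite B0 subn0 addn0.
  have {}IH := IH (ltnW lej).
  have /esym e : (M.+1 - j = (M.+1 - j.+1).+1)%N by lia.
  have := stepB j; have := stepA (M.+1 - j.+1)%N.
  have := mulAB (M.+1 - j.+1)%N j.
  rewrite e (_ : M.+1 - j.+1 + j = M)%N; last by lia.
  by move: IH eqM; lia.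
have := cnt M.+1 (leqnn _); rewrite subnn A0.
by have := leB M.+1; have := leA M.+1; move: leM; lia.
Qed.

(** * The dimension formula in degree at least 2 g - 1 *)

Section LargeDegree.
Variables (K F : fieldType) (iota : {rmorphism K -> F}).
Hypothesis hF : function_field iota.
Hypothesis hK : full_constant_field iota.
Variable g : nat.
Hypothesis hg : genus_is iota g.
Variable Pinf : place iota.
Hypothesis hdeg : deg_place Pinf = 1%N.
Implicit Types (P Q : place iota) (D E : place iota -> int).

(** A function realizing the first jump times one realizing the second has the sum of their pole
    orders at Pinf. *)
Lemma ell_jump_add D i l :
  is_divisor D ->
  (ell (D \+ place_mul Pinf (i - 1)) < ell (D \+ place_mul Pinf i))%N ->
  (ell (place_mul Pinf (l - 1)) < ell (place_mul Pinf l))%N ->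
  (ell (D \+ place_mul Pinf (i + l - 1)) <
   ell (D \+ place_mul Pinf (i + l)))%N.
Proof.
move=> dD.
have dm n := is_divisor_place_mul Pinf n.
have dDm n := is_divisorD dD (dm n).
have fin E : is_divisor E -> fin_RR E := fin_RR_divisor hF hg Pinf (D := E).
have add0 n : (fun _ : place iota => 0) \+ place_mul Pinf n = place_mul Pinf n.
  by apply/funext => P /=; rewrite add0r.
move=> /(ell_lt_exists (fin _ (dDm _)))[f Ef /(RR_val_exact Ef)[f0 vf]].
rewrite -(add0 l) -(add0 (l - 1)).
move=> /(ell_lt_exists (fin _ _))[|h Eh /(RR_val_exact Eh)[h0 vh]].
  by rewrite add0.
apply: (ell_lt (f := f * h)) => //; try exact: fin.
- by move=> P; rewrite /= lerD2l /place_mul; case: ifP => // _; rewrite gerBl.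
- have := RR_mul Ef Eh; congr RR_space; apply/funext => P.
  by rewrite /= add0r -addrA; congr (_ + _); rewrite /place_mul; case: ifP.
- case=> [/eqP|/(_ Pinf)]; first by rewrite mulf_eq0 (negbTE f0) (negbTE h0).
  rewrite (valM (place_valP Pinf)) // vf vh /= /place_mul eqxx; lia.
Qed.

Lemma ell_large_degree D : is_divisor D -> 2 * g%:Z - 1 <= deg_divisor D ->
  (ell D)%:Z = deg_divisor D + 1 - g%:Z.
Proof.
move=> dD leD; apply/eqP; rewrite eq_le (riemann_ineq hg dD) andbT.
have dm n := is_divisor_place_mul Pinf n.
have dDm n := is_divisorD dD (dm n).
have fin E : is_divisor E -> fin_RR E := fin_RR_divisor hF hg Pinf (D := E).
(* Shifting by e puts degree -1 at index 0 and D itself at index e, so the assumption on the degree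
   becomes 2 g <= e. *)
have [e eE] : exists e : nat, e%:Z = deg_divisor D + 1.
  by exists `|(deg_divisor D + 1)%R|%N; rewrite gez0_abs //; lia.
pose E0 : place iota -> int := fun=> 0.
have dE0 : is_divisor E0 by apply: (@is_divisor_seq _ _ _ _ [::]).
pose S D' (n : int) (k : nat) := ell (D' \+ place_mul Pinf (k%:Z - n)).
have degS D' n (k : nat) : is_divisor D' ->
    deg_divisor (D' \+ place_mul Pinf (k%:Z - n)) = deg_divisor D' + (k%:Z - n).
  by move=> dD'; rewrite deg_divisorD // deg_place_mul hdeg mulr1.
have stepS D' n k : is_divisor D' ->
    (S D' n k <= S D' n k.+1 <= (S D' n k).+1)%N.
  move=> dD'; have d1 m := is_divisorD dD' (dm m).
  have le1 P : (D' \+ place_mul Pinf (k%:Z - n)) P <=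
               (D' \+ place_mul Pinf (k.+1%:Z - n)) P.
    by rewrite /= lerD2l /place_mul; case: ifP => // _; lia.
  have [_ ->] := ell_le le1 (fin _ (d1 _)).
  have [_] := ell_le_deg hF (d1 _) (d1 _) le1 (fin _ (d1 _)).
  by rewrite !degS // /S; lia.
have riemS D' n k : is_divisor D' -> n = deg_divisor D' + 1 ->
    (k <= S D' n k + g)%N.
  move=> dD' nE; have := riemann_ineq hg (is_divisorD dD' (dm (k%:Z - n))).
  by rewrite degS // /S; lia.
have S0 D' n : is_divisor D' -> n = deg_divisor D' + 1 -> S D' n 0%N = 0%N.
  move=> dD' nE; apply: (ell_neg hF hK hg Pinf (is_divisorD dD' (dm _))).
  by rewrite degS //; lia.
have degE0 : 1 = deg_divisor E0 + 1 by rewrite deg_divisor0.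
have jump M : (2 * g <= M)%N -> (S D e%:Z M < S D e%:Z M.+1)%N.
  apply: (@jump_count _ (S E0 1) g); do ?[exact: S0|move=> i; exact: stepS
    | move=> i; exact: riemS].
  move=> i l; rewrite /S => hi hl.
  have shift k : k.+1%:Z - e%:Z - 1 = k%:Z - e%:Z by lia.
  have := @ell_jump_add D (i.+1%:Z - e%:Z) l%:Z dD.
  rewrite shift => /(_ hi).
  rewrite (_ : i.+1%:Z - e%:Z + l%:Z = (i + l).+1%:Z - e%:Z); last by lia.
  rewrite shift; apply.
  have add0 n : E0 \+ place_mul Pinf n = place_mul Pinf n.
    by apply/funext => P /=; rewrite add0r.
  by move: hl; rewrite !add0 (_ : l.+1%:Z - 1 = l%:Z) //; lia.
(* Every index from e on is a jump, so the Riemann equality at a distant index descends to D. *)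
have SeE n : S D e%:Z (e + n)%N = (S D e%:Z e + n)%N.
  elim: n => [|n IH]; first by rewrite !addn0.
  have := stepS D e%:Z (e + n)%N dD; have := jump (e + n)%N.
  by rewrite !addnS; lia.
have [N hN] := ell_eventually_le hF hK hg Pinf dD.
have := hN N (leqnn N).
rewrite (_ : N%:Z = (e + N)%N%:Z - e%:Z); last by lia.
rewrite -/(S D e%:Z (e + N)%N) SeE degS // /S subrr.
rewrite (_ : D \+ place_mul Pinf 0 = D); first by lia.
by apply/funext => P; rewrite /= /place_mul; case: ifP; rewrite addr0.
Qed.

End LargeDegree.

(** * From vanishing expansion coefficients to vanishing order *)

Section LocalExpansions.
Variables (K F : fieldType) (iota : {rmorphism K -> F}) (P : place iota).
Variable L : local_field P.

Lemma compl_val_const n a x : val_ge (compl_val (c := local_compl L)) n x ->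
  val_ge (compl_val (c := local_compl L)) n (compl_emb L (iota a) * x).
Proof.
have [-> _|a0] := eqVneq a 0; first by left; rewrite !rmorph0 mul0r.
move=> hx; rewrite -[n]add0r; apply: (val_geM (compl_valP _)) hx; right.
by rewrite compl_val_emb place_const.
Qed.

Lemma residue_repZ a (b : residue_field L) :
  residue_rep L (a *: b) = compl_emb L (iota a) * residue_rep L b.
Proof. by rewrite -mulr_algl rmorphM residue_rep_const. Qed.

Lemma local_expansion_val_ge (I : finType) (y : I -> F) (z : F)
    (beta : I -> nat -> residue_field L) (l : nat) (c : I -> K) :
  (forall r, local_expansion z (y r) (beta r)) ->
  (forall k, (k < l)%N -> \sum_r c r *: beta r k = 0) ->
  val_ge P l%:Z (lincomb iota y c).
Proof.
move=> hy c0; suff : val_ge (compl_val (c := local_compl L)) l%:Z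
    (compl_emb L (lincomb iota y c)).
  case=> [/eqP|]; first by rewrite fmorph_eq0 => /eqP; left.
  by rewrite compl_val_emb; right.
(* The expansions truncated at l cancel in the combination, leaving only remainders of valuation at
   least l. *)
have -> : compl_emb L (lincomb iota y c) = \sum_r compl_emb L (iota (c r)) *
   (compl_emb L (y r)
    - \sum_(k < l) residue_rep L (beta r k) * compl_emb L z ^+ k).
  under [in RHS]eq_bigr => r _ do rewrite mulrBr -rmorphM.
  rewrite sumrB -rmorph_sum -[LHS]subr0; congr (_ - _); apply/esym.
  under eq_bigr => r _ do rewrite mulr_sumr.
  rewrite exchange_big big1 //= => k _.
  under eq_bigr => r _ do rewrite mulrA -residue_repZ.
  by rewrite -mulr_suml -rmorph_sum c0 // rmorph0 mul0r.
apply: (val_ge_sum (compl_valP _)) => r _.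
by apply: compl_val_const; apply: hy.
Qed.

(** The first l e rows hold exactly the coordinates of the coefficients of index k < l. *)
Lemma columnwise_val_ge (I : finType) (y : I -> F) (z : F)
    (beta : I -> nat -> residue_field L) (e l : nat) (c : I -> K)
    (bas : e.-tuple (residue_field L)) (C : nat -> I -> K) :
  basis_of fullv bas ->
  (forall r, local_expansion z (y r) (beta r)) ->
  (forall k r (h : 'I_e), C (k * e + h)%N r = coord bas h (beta r k)) ->
  (forall j, (j < l * e)%N -> \sum_r c r * C j r = 0) ->
  val_ge P l%:Z (lincomb iota y c).
Proof.
move=> bb hy hC c0; apply: (local_expansion_val_ge hy) => k lk.
rewrite (coord_span (X := bas) (v := \sum_r c r *: beta r k)).
  rewrite big1 // => h _; rewrite (_ : coord bas h _ = 0) ?scale0r //.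
  rewrite linear_sum -[RHS](c0 (k * e + h)%N).
    by apply: eq_bigr => r _; rewrite linearZ hC.
  by have := ltn_ord h; nia.
by rewrite (span_basis bb) memvf.
Qed.

End LocalExpansions.

(** * Pole numbers of Pinf and the functions defining the columns *)

Section NongapColumns.
Variables (K F : fieldType) (iota : {rmorphism K -> F}).
Hypothesis hF : function_field iota.
Hypothesis hK : full_constant_field iota.
Variable g : nat.
Hypothesis hg : genus_is iota g.
Variable Pinf : place iota.
Hypothesis hdeg : deg_place Pinf = 1%N.
Variable nn : nat -> nat.
Hypothesis hnn : increasing_enumeration (~` [set n | gap_number Pinf n]) nn.

Lemma nongap_mono : {homo nn : i j / (i < j)%N}.
Proof. by case: hnn => h _; apply: homo_ltn h => x y z; apply: ltn_trans. Qed.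

Lemma nongap_inj : injective nn.
Proof.
move=> i j eij; have [lij|lji|//] := ltngtP i j.
  by move/nongap_mono: lij; rewrite eij ltnn.
by move/nongap_mono: lji; rewrite eij ltnn.
Qed.

(** ell ((k - 1) Pinf) grows by at most one per step and only at non-gaps, and just nn 0, ..., nn (r
    - 1) can lie below k. *)
Lemma ell_nongap_le r k : (k <= nn r)%N ->
  (ell (place_mul Pinf (k%:Z - 1)) <= r)%N.
Proof.
pose B k := ell (place_mul Pinf (k%:Z - 1)); rewrite -/(B k).
have dm n := is_divisor_place_mul Pinf n.
have Bge n : (B n <= B n.+1 <= (B n).+1)%N.
  have le1 P : place_mul Pinf (n%:Z - 1) P <= place_mul Pinf (n.+1%:Z - 1) P.
    by rewrite /place_mul; case: ifP => // _; lia.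
  have fn := fin_RR_divisor hF hg Pinf (dm (n%:Z - 1)).
  have fn1 := fin_RR_divisor hF hg Pinf (dm (n.+1%:Z - 1)).
  have [_ ->] := ell_le le1 fn1.
  have [_] := ell_le_deg hF (dm _) (dm _) le1 fn.
  by rewrite !deg_place_mul hdeg /B; lia.
have Bgap n : (forall i, nn i <> n) -> B n.+1 = B n.
  move=> hn; have : gap_number Pinf n.
    apply: contrapT => ngap; have [_ /seteqP[_ /(_ n ngap)]] := hnn.
    by case=> i _ /hn.
  case=> _; rewrite /B (_ : n.+1%:Z - 1 = n%:Z) //; lia.
have Bgaps a d : (forall i, ~~ (a <= nn i < a + d)%N) -> B (a + d)%N = B a.
  elim: d => [|d IH] h; first by rewrite addn0.
  rewrite addnS Bgap ?IH // => i.
    by apply: contra (h i) => /andP[-> /leq_trans->] //; rewrite addnS.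
  by move=> e; move: (h i); rewrite e leq_addr addnS leqnn.
have Bmono : {homo B : i j / (i <= j)%N}.
  by apply: homo_leq => // [i j l|n]; [apply: leq_trans | case/andP: (Bge n)].
elim: r k => [|r IH] k lek.
  have := Bgaps 0%N k; rewrite add0n => ->.
    have : ell (place_mul Pinf (- 1)) = 0%N.
      by apply: (ell_neg hF hK hg Pinf) => //; rewrite deg_place_mul hdeg.
    by rewrite /B sub0r => ->.
  move=> i; rewrite -leqNgt (leq_trans lek) //.
  by case: i => // i; apply/ltnW/nongap_mono.
have [/IH/leqW//|ltk] := leqP k (nn r).
(* No non-gap lies strictly between nn r and k, so B is constant from nn r + 1 to k. *)
have /(Bgaps (nn r).+1 (k - (nn r).+1)%N) : forall i,
    ~~ ((nn r).+1 <= nn i < (nn r).+1 + (k - (nn r).+1))%N.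
  move=> i; rewrite subnKC //; apply/negP => /andP[lt1 lt2].
  have [lir|lri] := leqP i r.
    move: lt1; rewrite ltnNge; have [->|ne] := eqVneq i r.
      by rewrite leqnn.
    by rewrite ltnW // nongap_mono // ltn_neqAle ne.
  have : (nn r.+1 <= nn i)%N.
    have [->//|ne] := eqVneq r.+1 i; apply/ltnW/nongap_mono.
    by rewrite ltn_neqAle ne.
  by move: lek lt2; lia.
rewrite subnKC // => ->.
by have := Bge (nn r); have := IH _ (leqnn (nn r)); lia.
Qed.

(** Otherwise ell ((g + r) Pinf) <= r, while the Riemann bound gives r + 1. *)
Lemma nongap_le r : (nn r <= g + r)%N.
Proof.
rewrite leqNgt; apply/negP => /ell_nongap_le.
have := riemann_ineq hg (is_divisor_place_mul Pinf ((g + r).+1%:Z - 1)).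
by rewrite deg_place_mul hdeg; lia.
Qed.

Variable y : nat -> F.
Hypothesis hy : forall r, RR_space (place_mul Pinf (nn r)%:Z) (y r) /\
                  ~ RR_space (place_mul Pinf ((nn r)%:Z - 1)) (y r).

Lemma column_val r : y r != 0 /\ Pinf (y r) = - (nn r)%:Z.
Proof.
have add0 n : (fun _ : place iota => 0) \+ place_mul Pinf n = place_mul Pinf n.
  by apply/funext => P /=; rewrite add0r.
have [] := hy r; rewrite -(add0 (nn r)%:Z) -(add0 ((nn r)%:Z - 1)).
move=> h1 /(RR_val_exact h1).
by rewrite add0r.
Qed.

Lemma column_indep m : indep_mod iota [set 0] (fun r : 'I_m => y r).
Proof.
move=> c /= c0 r; have /eqP : iota (c r) * y r = 0.
  move: r; apply: (distinct_val_sum0 (place_valP Pinf)) c0 => i j.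
  rewrite !mulf_eq0 !negb_or !fmorph_eq0 => /andP[ci yi] /andP[cj yj].
  rewrite !(valM (place_valP Pinf)) ?fmorph_eq0 // !place_const // !add0r.
  rewrite !(column_val _).2 => /oppr_inj[/nongap_inj]; exact: val_inj.
by rewrite mulf_eq0 fmorph_eq0 (negbTE (column_val r).1) orbF => /eqP.
Qed.

Lemma column_RR m r : (r < m)%N ->
  RR_space (place_mul Pinf (g%:Z + m%:Z - 1)) (y r).
Proof.
move=> rm; apply: RR_le (hy r).1 => P; rewrite /place_mul; case: ifP => // _.
by have := nongap_le r; lia.
Qed.

(** As the y r are independent, the left kernel of M embeds into L(D); hence the rank is at least m
    - ell D >= n. *)
Lemma row_full_of_RR_kernel m n (M : 'M[K]_(m, n)) (D : place iota -> int) :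
  fin_RR D ->
  (forall u : 'rV_m, u *m M = 0 ->
     RR_space D (lincomb iota (fun r : 'I_m => y r) (u 0))) ->
  (ell D + n <= m)%N -> row_full M.
Proof.
move=> fD kerD leDn.
have : (\rank (kermx M) <= ell D)%N.
  pose u := row_base (kermx M); rewrite -[X in (X <= _)%N]card_ord.
  apply: (ell_card_le (b := fun k =>
    lincomb iota (fun r : 'I_m => y r) (row k u 0))) => // [k|c c0 k].
    apply: kerD; apply/sub_kermxP; rewrite -(eq_row_base (kermx M)).
    exact: row_sub.
  pose w : 'rV_(\rank (kermx M)) := \row_k c k.
  suff : w *m u = 0.
    move/eqP; rewrite mulmx_free_eq0 ?row_base_free // => /eqP/rowP/(_ k).
    by rewrite !mxE.
  apply/rowP => r; rewrite [RHS]mxE; move: r.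
  apply: (column_indep (c := fun r => (w *m u) 0 r)).
  rewrite /= -[RHS]c0 /lincomb.
  under eq_bigr => r _ do rewrite mxE rmorph_sum mulr_suml.
  rewrite exchange_big; apply: eq_bigr => k' _; rewrite mulr_sumr.
  by apply: eq_bigr => r _; rewrite !mxE rmorphM mulrA.
rewrite mxrank_ker /row_full eqn_leq rank_leq_col /=.
by have := rank_leq_row M; lia.
Qed.

End NongapColumns.

(** * Base-q digits and elementary intervals *)

Section Digits.
Variable q : nat.
Hypothesis q_gt0 : (0 < q)%N.

Lemma base_digit_lt n r : (base_digit q n r < q)%N.
Proof. exact: ltn_pmod. Qed.

Lemma modn_expS n m :
  (n %% q ^ m.+1 = base_digit q n m * q ^ m + n %% q ^ m)%N.
Proof.
have lt : (base_digit q n m * q ^ m + n %% q ^ m < q ^ m.+1)%N.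
  have := base_digit_lt n m; have : (n %% q ^ m < q ^ m)%N.
    by rewrite ltn_pmod // expn_gt0 q_gt0.
  by rewrite expnS; nia.
rewrite -[RHS](modn_small lt) -[RHS](modnMDl (n %/ q ^ m %/ q)).
congr (_ %% _)%N.
rewrite addnA expnS mulnA -mulnDl /base_digit -divn_eq; exact: divn_eq.
Qed.

Lemma base_digit_inj m n n' : (n < q ^ m)%N -> (n' < q ^ m)%N ->
  (forall r, (r < m)%N -> base_digit q n r = base_digit q n' r) -> n = n'.
Proof.
move=> lt lt' e; rewrite -(modn_small lt) -(modn_small lt').
elim: m e {lt lt'} => [|m IH] e; first by rewrite !modn1.
by rewrite !modn_expS e // IH // => r rm; apply/e/ltnW.
Qed.

Lemma base_digit_block_lt k m n r : (r < m)%N ->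
  base_digit q (k * q ^ m + n) r = base_digit q n r.
Proof.
move=> rm; rewrite /base_digit -(subnK (ltnW rm)) expnD mulnA.
rewrite divnMDl ?expn_gt0 ?q_gt0 // (_ : m - r = (m - r.+1).+1)%N; last by lia.
by rewrite expnS mulnCA mulnC modnMDl.
Qed.

Lemma base_digit_block_ge k m n r : (n < q ^ m)%N ->
  base_digit q (k * q ^ m + n) (m + r) = base_digit q k r.
Proof.
move=> nm; rewrite /base_digit expnD divnMA divnMDl ?expn_gt0 ?q_gt0 //.
by rewrite (divn_small nm) addn0.
Qed.

Lemma base_digit_small n r : (n < q ^ r)%N -> base_digit q n r = 0%N.
Proof. by move=> h; rewrite /base_digit divn_small // mod0n. Qed.

(** The m-digit truncation scaled by q ^ m: its most significant digit is [dig 0], which is why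
    digit positions are reversed below. *)
Fixpoint prefix_number (dig : nat -> nat) (m : nat) : nat :=
  if m is m'.+1 then (prefix_number dig m' * q + dig m')%N else 0%N.

Variable dig : nat -> nat.
Hypothesis dig_lt : forall j, (dig j < q)%N.

Lemma prefix_number_lt m : (prefix_number dig m < q ^ m)%N.
Proof.
by elim: m => [|m IH] //=; have := dig_lt m; rewrite expnSr; nia.
Qed.

Lemma prefix_number_div m k :
  (prefix_number dig (m + k) %/ q ^ k = prefix_number dig m)%N.
Proof.
elim: k => [|k IH]; first by rewrite addn0 divn1.
by rewrite addnS /= expnS divnMA divnMDl // (divn_small (dig_lt _)) addn0 IH.
Qed.

Lemma base_digit_prefix d j : (j < d)%N ->
  base_digit q (prefix_number dig d) (d - j.+1) = dig j.
Proof.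
move=> jd; rewrite /base_digit -{1}(subnKC jd) prefix_number_div /=.
by rewrite modnMDl modn_small.
Qed.

Lemma prefix_numberP d a : (a < q ^ d)%N ->
  reflect (forall j, (j < d)%N -> dig j = base_digit q a (d - j.+1))
          (prefix_number dig d == a).
Proof.
move=> ad; apply: (iffP eqP) => [<- j jd|h].
  by rewrite base_digit_prefix.
apply: (base_digit_inj (prefix_number_lt d) ad) => r rd.
have jd : (d - r.+1 < d)%N by lia.
have := base_digit_prefix jd; rewrite (h _ jd).
by rewrite (_ : d - (d - r.+1).+1 = r)%N //; lia.
Qed.

Variable R : realType.

Lemma expansion_seriesE m :
  expansion_series R q dig m = (prefix_number dig m)%:R / q%:R ^+ m.
Proof.
have q0 : (q%:R : R) != 0 by rewrite pnatr_eq0 -lt0n.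
rewrite /expansion_series /series /=; elim: m => [|m IH].
  by rewrite big_geq // mul0r.
rewrite big_nat_recr //= IH natrD natrM mulrDl; congr (_ + _).
by rewrite exprSr -mulf_div divff // mulr1.
Qed.

Lemma expansion_series_lt1 m : 0 <= expansion_series R q dig m < 1.
Proof.
have qm : (0 < q%:R ^+ m :> R) by rewrite exprn_gt0 // ltr0n.
rewrite expansion_seriesE divr_ge0 ?ler0n ?ltW //=.
by rewrite ltr_pdivrMr // mul1r -natrX ltr_nat prefix_number_lt.
Qed.

(** After scaling by q ^ m, membership says that integer division of the prefix number by q ^ (m -
    d) yields a. *)
Lemma expansion_series_interval m d a : (d <= m)%N ->
  (a%:R / q%:R ^+ d <= expansion_series R q dig m) &&
  (expansion_series R q dig m < a.+1%:R / q%:R ^+ d) =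
  (prefix_number dig d == a).
Proof.
move=> /subnKC <-; set k := (m - d)%N.
have q0 i : (0 < q%:R ^+ i :> R) by rewrite exprn_gt0 // ltr0n.
have qk : (0 < q ^ k)%N by rewrite expn_gt0 q_gt0.
have e i : i%:R / q%:R ^+ d = (i * q ^ k)%:R / q%:R ^+ (d + k) :> R.
  by rewrite natrM natrX exprD -mulf_div divff ?mulr1 // lt0r_neq0.
rewrite !e expansion_seriesE ler_pM2r ?invr_gt0 // ltr_pM2r ?invr_gt0 //.
rewrite ler_nat ltr_nat -(prefix_number_div d k) -leq_divRL //.
by rewrite -ltn_divLR // ltnS eqn_leq andbC.
Qed.

Lemma expansion_series_cvg :
  expansion_series R q dig @ \oo --> limn (expansion_series R q dig) /\
  0 <= limn (expansion_series R q dig) <= 1.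
Proof.
have cv : cvgn (expansion_series R q dig).
  apply: nondecreasing_is_cvgn.
    apply/nondecreasing_seqP => n; rewrite /expansion_series /series /=.
    by rewrite big_nat_recr //= lerDl divr_ge0 // exprn_ge0.
  exists 1 => _ [n _ <-]; apply: ltW.
  by have /andP[] := expansion_series_lt1 n.
split=> //; apply/andP; split.
  apply: limr_ge => //; apply: nearW => n.
  by have /andP[] := expansion_series_lt1 n.
apply: limr_le => //; apply: nearW => n; apply: ltW.
by have /andP[] := expansion_series_lt1 n.
Qed.

End Digits.

(** * Independence of the rows of the generating matrices *)

Section ColumnMatrix.
Variables (K : finFieldType) (F : fieldType) (iota : {rmorphism K -> F}).
Hypothesis hF : function_field iota.
Hypothesis hK : full_constant_field iota.
Variable g : nat.
Hypothesis hg : genus_is iota g.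
Variable s : nat.
Variables (Pinf : place iota) (P : 'I_s -> place iota).
Hypothesis hP : injective P.
Hypothesis hPinf : forall i, P i <> Pinf.
Hypothesis hdeg : deg_place Pinf = 1%N.
Variable nn : nat -> nat.
Hypothesis hnn : increasing_enumeration (~` [set n | gap_number Pinf n]) nn.
Variable y : nat -> F.
Hypothesis hy : forall r, RR_space (place_mul Pinf (nn r)%:Z) (y r) /\
                  ~ RR_space (place_mul Pinf ((nn r)%:Z - 1)) (y r).
Variables (L : forall i, local_field (P i)) (z : 'I_s -> F).
Variable beta : forall i, nat -> nat -> residue_field (L i).
Hypothesis hbeta :
  forall i r, local_expansion (z i) (y r) (fun k => beta i k r).
Variable bas : forall i, (deg_place (P i)).-tuple (residue_field (L i)).
Hypothesis hbas : forall i, basis_of fullv (bas i).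
Variable C : 'I_s -> nat -> nat -> K.
Hypothesis hC : columnwise_matrices bas beta C.

Definition row_index (d : 'I_s -> nat) := {i : 'I_s & 'I_(d i)}.

(** Transposed, so that a digit vector acts as a row vector from the left; [row_full] then means
    that the selected rows of the matrices C i, cut to m entries, are independent. *)
Definition column_matrix m (d : 'I_s -> nat) : 'M[K]_(m, #|{: row_index d}|) :=
  \matrix_(r < m, k < #|{: row_index d}|)
    let x : row_index d := enum_val k in C (tag x) (tagged x) r.

Lemma card_row_index d : #|{: row_index d}| = (\sum_i d i)%N.
Proof.
rewrite card_tagged sumnE big_map big_enum.
by apply: eq_bigr => i _; rewrite card_ord.
Qed.

Lemma column_matrix_row_full m (d : 'I_s -> nat) : (0 < m)%N ->
  (forall i, deg_place (P i) %| d i)%N -> (g + \sum_i d i <= m)%N ->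
  row_full (column_matrix m d).
Proof.
move=> m0 ed lem; pose l i := (d i %/ deg_place (P i))%N.
have dE i : (l i * deg_place (P i) = d i)%N by rewrite /l divnK.
pose D0 := place_mul Pinf (g%:Z + m%:Z - 1).
(* deg D = g + m - 1 - sum d_i is at least 2 g - 1 exactly when g + sum d_i <= m. *)
pose Z (i : 'I_s) := place_mul (P i) (- (l i)%:Z).
pose D := D0 \+ (fun Q => \sum_i Z i Q).
have dD0 : is_divisor D0 by apply: is_divisor_place_mul.
have dZ i : is_divisor (Z i) by apply: is_divisor_place_mul.
have dsZ := is_divisor_sum (index_enum 'I_s) dZ.
have dD : is_divisor D by apply: is_divisorD.
have degD : deg_divisor D = g%:Z + m%:Z - 1 - (\sum_i d i)%N%:Z.
  rewrite deg_divisorD // deg_place_mul hdeg mulr1 deg_divisor_sum //.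
  rewrite (big_morph Posz PoszD (erefl (0 : int))) -sumrN; congr (_ + _).
  by apply: eq_bigr => i _; rewrite deg_place_mul mulNr -dE PoszM.
have ellD : (ell D)%:Z = m%:Z - (\sum_i d i)%N%:Z.
  rewrite (ell_large_degree hF hK hg hdeg dD) degD; first by lia.
  by move: lem; lia.
apply: (row_full_of_RR_kernel hdeg hnn hy (D := D)).
- exact: (fin_RR_divisor hF hg Pinf).
- move=> u uM; apply/RR_val_ge => Q.
  have /RR_val_ge/(_ Q) :
      RR_space D0 (lincomb iota (fun r : 'I_m => y r) (u 0)).
    apply: subspace_lincomb; first exact: RR_subspace.
    by move=> r; apply: (column_RR hF hK hg hdeg hnn hy).
  have [[i ->]|nQ] := pselect (exists i, Q = P i).
    move=> _; rewrite /D /D0 /= /place_mul; case: eqP => [/hPinf//|_].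
    rewrite add0r (bigD1 i) //= big1 => [|j ji]; last first.
      by rewrite /Z /place_mul; case: eqP => // /hP ij; rewrite ij eqxx in ji.
    rewrite addr0 /Z /place_mul eqxx opprK.
    apply: (columnwise_val_ge (hbas i) (z := z i)
      (beta := fun r : 'I_m => fun k => beta i k r) (C := fun j r => C i j r)).
    + by move=> r; apply: hbeta.
    + by move=> k r h; apply: hC.
    + rewrite dE => j jd.
      pose k : row_index d := Tagged (fun i => 'I_(d i)) (Ordinal jd).
      move/rowP/(_ (enum_rank k)): uM; rewrite !mxE; apply: etrans.
      by apply: eq_bigr => r _; rewrite mxE enum_rankK.
  rewrite /D /= big1 ?addr0 // => i _; rewrite /Z /place_mul.
  by case: eqP => // e; case: nQ; exists i.
- by rewrite card_row_index; move: ellD lem; lia.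
Qed.

End ColumnMatrix.

(** By surjectivity all |K| ^ n fibres are translates of one another, and they partition K ^ m. *)
Lemma card_row_full_fiber (K : finFieldType) m n (M : 'M[K]_(m, n))
    (t : 'rV_n) : row_full M ->
  (#|[set u : 'rV[K]_m | u *m M == t]%SET| * #|K| ^ n = #|K| ^ m)%N.
Proof.
case/row_fullP => B BM; pose fib t' := [set u : 'rV[K]_m | u *m M == t']%SET.
have fibE t' : #|fib t'| = #|fib t|.
  have [v vM] : exists v : 'rV_m, v *m M = t - t'.
    by exists ((t - t') *m B); rewrite -mulmxA BM mulmx1.
  rewrite -(card_imset (mem (fib t')) (addIr v)).
  apply: eq_card => u; rewrite [RHS]inE; apply/imsetP/eqP => [[w]|e].
    by rewrite inE => /eqP e ->; rewrite mulmxDl e vM addrC subrK.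
  exists (u - v); last by rewrite subrK.
  by rewrite inE mulmxBl e vM opprB addrC subrK.
have <- : #|{: 'rV[K]_m}| = (#|K| ^ m)%N by rewrite card_mx mul1n.
rewrite -[RHS]sum1_card [RHS](partition_big (fun u => u *m M) predT) //=.
rewrite [RHS](eq_bigr (fun _ => #|fib t|)) => [|t' _].
  by rewrite sum_nat_const card_mx mul1n mulnC.
by rewrite -(fibE t') -sum1_card; apply: eq_bigl => u; rewrite inE.
Qed.

(** * The digital method on a block of q ^ m indices *)

Section DigitalSequence.
Variables (q : nat) (K : finFieldType) (s : nat) (C : 'I_s -> nat -> nat -> K).
Hypothesis hq : #|K| = q.
Variable psi : nat -> nat -> K.
Hypothesis hpsi : forall r, set_bij `I_q [set: K] (psi r).
Hypothesis hpsi0 : exists r0 : nat, forall r, (r0 <= r)%N -> psi r 0%N = 0.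

Lemma base_gt1 : (1 < q)%N.
Proof. by rewrite -hq; apply: finRing_gt1. Qed.

Let q_gt0 : (0 < q)%N := ltnW base_gt1.

Definition digit_row m (n : 'I_(q ^ m)) : 'rV[K]_m :=
  \row_r psi r (base_digit q n r).

Lemma digit_row_bij m : bijective (@digit_row m).
Proof.
apply: inj_card_bij => [n n' /rowP e|].
  apply: val_inj.
  apply: (base_digit_inj q_gt0 (ltn_ord n) (ltn_ord n')) => r rm.
  have := e (Ordinal rm); rewrite !mxE /=.
  by have [_ inj _] := hpsi r; apply: inj; rewrite inE; apply: base_digit_lt.
by rewrite card_mx mul1n hq card_ord.
Qed.

Lemma digital_y_sum n i j N : (n < q ^ N)%N ->
  (forall r, (N <= r)%N -> psi r 0%N = 0) ->
  digital_y q C psi n i j = \sum_(r < N) C i j r * psi r (base_digit q n r).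
Proof.
move=> nN psiN; rewrite /digital_y (@fsbigE _ _ _ _ _ (iota 0 N)) ?iota_uniq //.
  rewrite -[N in iota 0 N]subn0 -/(index_iota 0 N) big_mkord.
  by apply: eq_bigl => r; rewrite in_setT.
move=> r _; rewrite mem_iota /= add0n -leqNgt => Nr.
rewrite base_digit_small ?psiN ?mulr0 //.
by apply: leq_trans nN _; rewrite leq_exp2l // base_gt1.
Qed.

(** The low m digits of k q ^ m + n are those of n and the higher ones those of k, so the map is
    affine in the digit row, with a constant t fixed by k. *)
Lemma digital_y_block m k : exists t : 'I_s -> nat -> K,
  forall (n : 'I_(q ^ m)) i j, digital_y q C psi (k * q ^ m + n)%N i j =
    \sum_(r < m) digit_row n 0 r * C i j r + t i j.
Proof.
have [r0 psi0] := hpsi0.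
exists (fun i j =>
  \sum_(r < r0 + k) C i j (m + r)%N * psi (m + r)%N (base_digit q k r)).
(* Beyond position m + r0 + k the digits vanish, as k < q ^ (r0 + k), and psi maps 0 to 0. *)
move=> n i j; rewrite (@digital_y_sum _ _ _ (m + (r0 + k))).
- rewrite big_split_ord /=; congr (_ + _); apply: eq_bigr => r _.
    by rewrite mxE base_digit_block_lt // mulrC.
  by rewrite base_digit_block_ge.
- rewrite expnD; have := ltn_ord n; have : (k.+1 <= q ^ (r0 + k))%N.
    apply: leq_trans (ltn_expl k base_gt1) _.
    by rewrite leq_exp2l ?base_gt1 // leq_addl.
  by nia.
- by move=> r h; apply: psi0; move: h; lia.
Qed.

End DigitalSequence.

(** * Equidistribution in elementary intervals *)

Section DigitalNet.
Variables (R : realType) (q : nat) (K : finFieldType) (s : nat).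
Variable C : 'I_s -> nat -> nat -> K.
Hypothesis hq : #|K| = q.
Variable psi : nat -> nat -> K.
Hypothesis hpsi : forall r, set_bij `I_q [set: K] (psi r).
Hypothesis hpsi0 : exists r0 : nat, forall r, (r0 <= r)%N -> psi r 0%N = 0.
Variable lambda : 'I_s -> nat -> K -> nat.
Hypothesis hlambda : forall i j, set_bij [set: K] `I_q (lambda i j).
Variables (g : nat) (e : 'I_s -> nat).
Hypothesis row_full_C : forall m (d : 'I_s -> nat), (0 < m)%N ->
  (forall i, e i %| d i)%N -> (g + \sum_i d i <= m)%N ->
  row_full (column_matrix C m d).

Let q_gt0 : (0 < q)%N := ltnW (base_gt1 hq).

Lemma digital_digit_lt n i j : (digital_digit q C psi lambda n i j < q)%N.
Proof. by have [fl _ _] := hlambda i j; apply: fl. Qed.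

Lemma box_volumeE (d a : 'I_s -> nat) :
  box_volume (fun i => (a i)%:R / q%:R ^+ d i)
             (fun i => (a i).+1%:R / q%:R ^+ d i) =
  (q%:R ^+ (\sum_i d i)%N)^-1 :> R.
Proof.
rewrite -prodrXr -prodfV; apply: eq_bigr => i _.
by rewrite -mulrBl -natrB // subSnn mul1r.
Qed.

Lemma box_volume_ge m (D : nat) : (g < m)%N ->
  (q%:R ^ (g%:Z - m%:Z) <= (q%:R ^+ D)^-1 :> R) = (g + D <= m)%N.
Proof.
move=> gm; have q1 : (1 < q%:R :> R) by rewrite ltr1n (base_gt1 hq).
have q0 k : (0 < q%:R ^+ k :> R) by rewrite exprn_gt0 // (lt_trans ltr01).
rewrite (_ : g%:Z - m%:Z = - (m - g)%N%:Z); last by lia.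
by rewrite -exprnN lef_pV2 ?posrE // ler_eXn2l // leq_subRL // ltnW.
Qed.

Lemma digital_net k m : (g < m)%N ->
  is_net (R := R) g e (fun (n : 'I_(q ^ m)) (i : 'I_s) =>
    expansion_series R q (digital_digit q C psi lambda (k * q ^ m + n)%N i) m).
Proof.
move=> gm; split=> [n i|d a ad ed lo hi].
  exact: (expansion_series_lt1 q_gt0 (digital_digit_lt _ _)).
rewrite box_volumeE box_volume_ge // => gd.
have dm i : (d i <= m)%N.
  apply: leq_trans gd; rewrite (bigD1 i) //=.
  by rewrite addnA addnAC leq_addl.
have rf : row_full (column_matrix C m d).
  by apply: row_full_C => //; apply: leq_ltn_trans gm.
have [t tE] := digital_y_block C hq hpsi0 m k.
(* tau (i, j) is the field element whose image under lambda is the digit that the interval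
   prescribes at place j of coordinate i. *)
have /choice[tau tauE] : forall x : 'I_s * nat, exists c : K,
    lambda x.1 x.2 c = base_digit q (a x.1) (d x.1 - x.2.+1).
  case=> i j; have [_ _ sl] := hlambda i j.
  have [|c _ <-] := sl (base_digit q (a i) (d i - j.+1)); last by exists c.
  exact: base_digit_lt.
pose w : 'rV[K]_#|{: row_index d}| :=
  \row_k let x : row_index d := enum_val k in
  tau (tag x, nat_of_ord (tagged x)) - t (tag x) (tagged x).
(* Digit rows biject the block with K ^ m, and injectivity of lambda turns the digit conditions into
   the linear system with right-hand side tau - t. *)
have cnt : box_count (fun (n : 'I_(q ^ m)) (i : 'I_s) => expansion_series R q
    (digital_digit q C psi lambda (k * q ^ m + n)%N i) m) lo hi =
    #|[set u : 'rV[K]_m | u *m column_matrix C m d == w]%SET|.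
  rewrite -(on_card_preimset (f := @digit_row q K psi m)); last first.
    by apply: onW_bij; apply: digit_row_bij.
  apply: eq_card => n; rewrite !inE; apply/forallP/eqP => [h|/rowP h i].
    apply/rowP => c; rewrite !mxE /=; set x : row_index d := enum_val c.
    have := h (tag x); rewrite (expansion_series_interval q_gt0) //; last first.
      exact: digital_digit_lt.
    move/(prefix_numberP q_gt0 (digital_digit_lt _ _) (ad _)).
    move=> /(_ (tagged x) (ltn_ord _)).
    rewrite -(tauE (tag x, nat_of_ord (tagged x))).
    have [_ il _] := hlambda (tag x) (tagged x).
    move=> /il; rewrite !in_setT => /(_ isT isT) <-.
    by rewrite tE addrK; apply: eq_bigr => r _; rewrite !mxE.
  rewrite (expansion_series_interval q_gt0) //; last exact: digital_digit_lt.
  apply/(prefix_numberP q_gt0 (digital_digit_lt _ _) (ad _)) => j jd.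
  rewrite -(tauE (i, j)) /=; congr (lambda i j _); rewrite tE.
  have := h (enum_rank (Tagged (fun i => 'I_(d i)) (Ordinal jd))).
  rewrite !mxE enum_rankK /= => hj.
  rewrite -[RHS](subrK (t i j)) -hj; congr (_ + _).
  by apply: eq_bigr => r _; rewrite !mxE enum_rankK.
have := card_row_full_fiber w rf; rewrite -cnt hq card_row_index.
move=> /(congr1 (fun n => n%:R : R)).
rewrite natrM !natrX => <-; rewrite mulfK //.
by rewrite expf_neq0 // pnatr_eq0 -lt0n.
Qed.

Lemma digital_is_sequence :
  is_sequence q g e (digital_sequence R q C psi lambda)
    (digital_digit q C psi lambda).
Proof.
split=> [n i|n i|k m gm]; last exact: digital_net.
  exact: (expansion_series_cvg q_gt0 (digital_digit_lt _ _) R).2.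
split; first exact: digital_digit_lt.
exact: (expansion_series_cvg q_gt0 (digital_digit_lt _ _) R).1.
Qed.

End DigitalNet.

Theorem theorem1 (R : realType)
  (q : nat) (K : finFieldType) (hq : #|K| = q)
  (s : nat) (hs : (1 <= s)%N)
  (F : fieldType) (iota : {rmorphism K -> F})
  (hF : function_field iota) (hK : full_constant_field iota)
  (g : nat) (hg : genus_is iota g)
  (Pinf : place iota) (P : 'I_s -> place iota)
  (hP : injective P) (hPinf : forall i, P i <> Pinf)
  (hdeg : deg_place Pinf = 1%N)
  (nn : nat -> nat)
  (hnn : increasing_enumeration (~` [set n | gap_number Pinf n]) nn)
  (y : nat -> F)
  (hy : forall r, RR_space (place_mul Pinf (nn r)%:Z) (y r) /\
                  ~ RR_space (place_mul Pinf ((nn r)%:Z - 1)) (y r))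
  (L : forall i, local_field (P i))
  (z : 'I_s -> F) (hz : forall i, P i (z i) = 1)
  (beta : forall i, nat -> nat -> residue_field (L i))
  (hbeta : forall i r, local_expansion (z i) (y r) (fun k => beta i k r))
  (bas : forall i, (deg_place (P i)).-tuple (residue_field (L i)))
  (hbas : forall i, basis_of fullv (bas i))
  (C : 'I_s -> nat -> nat -> K)
  (hC : columnwise_matrices bas beta C)
  (psi : nat -> nat -> K)
  (hpsi : forall r, set_bij `I_q [set: K] (psi r))
  (hpsi0 : exists r0 : nat, forall r, (r0 <= r)%N -> psi r 0%N = 0)
  (lambda : 'I_s -> nat -> K -> nat)
  (hlambda : forall i j, set_bij [set: K] `I_q (lambda i j)) :
  is_sequence q g (fun i => deg_place (P i))
    (digital_sequence R q C psi lambda) (digital_digit q C psi lambda).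
Proof.
apply: digital_is_sequence => // m d.
exact: (column_matrix_row_full hF hK hg hP hPinf hdeg hnn hy hbeta hbas hC).
Qed.
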